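(* For every $\theta\in\mathbb R$, $E[(\hat\theta_n-\theta)^2]<\infty$ for all sufficiently large $n$, and \[\lim_{n\to\infty}n\,E\!\left[(\hat\theta_n-\theta)^2\right]=\frac{m+1}{m(2m-1)}.\]
   Context: Fix $m>1/2$. Let $c_m:=\left(\int_{\mathbb R}(1+x^2)^{-m}\,dx\right)^{-1}$ and $f(x):=c_m(1+x^2)^{-m}$. For $\theta\in\mathbb R$, $\mathrm{PVII}_m(\theta,1)$ denotes the Pearson Type VII distribution with location $\theta$ and scale $1$, i.e. the law with density $x\mapsto f(x-\theta)$. Let $(X_n)_{n\ge1}$ be i.i.d. random variables on a probability space $(\Omega,\mathcal F,P)$ with law $\mathrm{PVII}_m(\theta,1)$. For each $n$, let $\hat\theta_n(x_1,\dots,x_n)$ be any Borel measurable function on $\mathbb R^n$ such that $\hat\theta_n(x_1,\dots,x_n)$ is a maximizer of $t\mapsto\prod_{i=1}^n f(x_i-t)$ over $t\in\mathbb R$, and let $\hat\theta_n:=\hat\theta_n(X_1,\dots,X_n)$ (the maximum likelihood estimator). *)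

(* Defs.v *)
From HB Require Import structures.
From mathcomp Require Import all_boot all_order all_algebra.
From mathcomp Require Import all_classical all_reals all_analysis.
Set Implicit Arguments. Unset Strict Implicit. Unset Printing Implicit Defensive.
Import Order.TTheory GRing.Theory Num.Theory.
Local Open Scope classical_set_scope.
Local Open Scope ring_scope.

Definition pvii_c (R : realType) (m : R) : R :=
  (fine (\int[@lebesgue_measure R]_x ((1 + x ^+ 2) `^ (- m))%:E))^-1.

Definition pvii_f (R : realType) (m : R) (x : R) : R :=
  pvii_c m * (1 + x ^+ 2) `^ (- m).

Definition has_law_PVII (R : realType) d (T : measurableType d)
  (P : probability T R) (m theta : R) (Y : T -> R) : Prop :=
  measurable_fun setT Y /\
  forall A : set R, measurable A ->
    P (Y @^-1` A) = (\int[@lebesgue_measure R]_(x in A) (pvii_f m (x - theta))%:E)%E.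

Definition mutually_independent (R : realType) d (T : measurableType d)
  (P : probability T R) (X : nat -> T -> R) : Prop :=
  forall (s : seq nat) (A : nat -> set R), uniq s ->
    (forall i, measurable (A i)) ->
    P (\big[setI/setT]_(i <- s) (X i @^-1` A i)) =
    (\prod_(i <- s) P (X i @^-1` A i))%E.

Definition pvii_likelihood (R : realType) (m : R) (n : nat) (x : n.-tuple R) (t : R) : R :=
  \prod_(xi <- x) pvii_f m (xi - t).

(* the estimator evaluated at the sample X_1..X_n (0-based indices here) *)
Definition mle_at (R : realType) (T : Type) (th : forall n : nat, n.-tuple R -> R)
  (X : nat -> T -> R) (n : nat) (w : T) : R :=
  th n [tuple X (val i) w | i < n].

(* Main.v *)
Require Import Defs.
From HB Require Import structures.
From mathcomp Require Import all_boot all_order all_algebra ring lra.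
From mathcomp Require Import all_classical all_reals all_analysis measurable_realfun.
Set Implicit Arguments. Unset Strict Implicit. Unset Printing Implicit Defensive.
Import Order.TTheory GRing.Theory Num.Theory.
Import numFieldNormedType.Exports.
Local Open Scope classical_set_scope.
Local Open Scope ring_scope.

(** Centre at theta: z_i = X_i - theta, e = the estimation error, and let
    a(z) = z / (1 + z^2) be the score up to the factor 2m.  Since e maximizes the
    likelihood, sum_i a(z_i - e) = 0; Taylor expansion, with globally bounded
    remainder, gives J e = A + e D + O(e^2), where A is the sample mean of a(z_i),
    J = E a'(z_1) and D is J minus the sample mean of a'(z_i).  As E A^2 = V / n and
    E D^2 = O(1 / n) follow from independence alone, no central limit theorem is
    needed: sqrt n (J e - A) -> 0 in L^2, hence n E e^2 -> V / J^2, as soon as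
    n E [e^4; |e| > delta] -> 0 for each delta > 0.  Once |e| > delta, at some point
    t of a fine grid around e the product of the square-rooted likelihood ratios is
    not much below 1; its expectation is h(t)^n with h(t) the Hellinger affinity of
    f and its translate f(. - t).  This affinity is bounded away from 1 for
    |t| >= delta / 2 and decays polynomially in t (by
    1 + t^2 <= 2 (1 + x^2) (1 + (x - t)^2)), so a union bound over the grid makes
    E [e^4; |e| > delta] exponentially small. *)

(** * Score equation and pointwise error bound *)

Section deterministic.
Context {R : realType}.
Implicit Types (e x z t : R) (n : nat).

Definition score x : R := x / (1 + x ^+ 2).
Definition dscore x : R := (1 - x ^+ 2) / (1 + x ^+ 2) ^+ 2.

Lemma sqrp1_gt0 x : 0 < 1 + x ^+ 2.
Proof. by rewrite ltr_pwDl// sqr_ge0. Qed.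

Lemma sqrp1_ge1 x : 1 <= 1 + x ^+ 2.
Proof. by rewrite lerDl sqr_ge0. Qed.

Lemma norm_score_le x : `|score x| <= 1 / 2.
Proof.
rewrite /score normrM normfV (gtr0_norm (sqrp1_gt0 x)).
rewrite ler_pdivrMr ?sqrp1_gt0// -(@real_normK _ x) ?num_real//.
by have := sqr_ge0 (`|x| - 1); nra.
Qed.

Lemma norm_dscore_le x : `|dscore x| <= 1.
Proof.
have q0 := sqrp1_gt0 x; have x2 := sqr_ge0 x.
rewrite /dscore normrM normfV (gtr0_norm (exprn_gt0 2 q0)).
rewrite ler_pdivrMr ?exprn_gt0// mul1r ler_norml; apply/andP; split; nra.
Qed.

(** [dscore] is the derivative of [score]. The bound holds for every [e], however large, so no prior
    localization of the estimator is needed. *)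
Lemma score_taylor z e : `|score (z - e) - score z + e * dscore z| <= 2 * e ^+ 2.
Proof.
have p0 := sqrp1_gt0 z; have q0 := sqrp1_gt0 (z - e).
pose p := 1 + z ^+ 2; pose q := 1 + (z - e) ^+ 2.
(* The remainder is exactly [e ^+ 2] times a combination of bounded fractions: at most 1 * (1/2 +
   1/2) + 1/2, rounded up to 2. *)
have -> : score (z - e) - score z + e * dscore z = e ^+ 2 *
    ((1 - z ^+ 2) / p * (- score (z - e) / p - score z / q) - score z / q).
  by rewrite /score /dscore /p /q; field; rewrite !gt_eqF.
rewrite normrM ger0_norm ?sqr_ge0// mulrC; apply: ler_wpM2r; first exact: sqr_ge0.
have inv1 x : `|(1 + x ^+ 2)^-1| <= 1.
  by rewrite ger0_norm ?invr_ge0 ?(ltW (sqrp1_gt0 _))// invf_le1 ?sqrp1_gt0 ?sqrp1_ge1.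
have H x y : `|score x / (1 + y ^+ 2)| <= 1 / 2.
  rewrite normrM -[leRHS]mulr1; apply: ler_pM => //; exact: norm_score_le.
have K : `|(1 - z ^+ 2) / p| <= 1.
  rewrite normrM normfV (gtr0_norm p0) ler_pdivrMr// mul1r ler_norml /p.
  by have := sqr_ge0 z; lra.
have H1 := H z (z - e); have H2 := H (z - e) z.
rewrite mulNr (le_trans (ler_normB _ _))//.
rewrite (_ : 2 = 1 * (1 / 2 + 1 / 2) + 1); last by lra.
apply: lerD; last by rewrite (le_trans H1)//; lra.
rewrite normrM; apply: ler_pM => //.
by rewrite (le_trans (ler_normB _ _))// normrN; apply: lerD.
Qed.

Lemma score_eq0 n (z : nat -> R) e :
  (forall t, \prod_(i < n) (1 + (z i - e) ^+ 2) <= \prod_(i < n) (1 + (z i - t) ^+ 2)) ->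
  \sum_(i < n) score (z i - e) = 0.
Proof.
move=> emin; case: n emin => [|n] emin; first by rewrite big_ord0.
set S := \sum_(i < _) _.
(* [1 + x <= expR x] turns the minimality of the product into a quadratic inequality in [h]. *)
have key h : 0 <= n.+1%:R * h ^+ 2 - 2 * h * S.
  have : 1 <= expR (\sum_(i < n.+1) (h ^+ 2 - 2 * h * score (z i - e))).
    have P0 : 0 < \prod_(i < n.+1) (1 + (z i - e) ^+ 2).
      by apply: prodr_gt0 => i _; exact: sqrp1_gt0.
    rewrite -(ler_pM2r P0) mul1r (le_trans (emin (e + h)))// expR_sum -big_split/=.
    apply: ler_prod => i _; rewrite (ltW (sqrp1_gt0 _))/=.
    set u := z i - e; rewrite (_ : z i - (e + h) = u - h); last by rewrite /u; ring.
    have u0 := sqrp1_gt0 u.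
    rewrite -ler_pdivrMr//; apply: le_trans (expR_ge1Dx _).
    rewrite ler_pdivrMr// /score.
    have -> : (1 + (h ^+ 2 - 2 * h * (u / (1 + u ^+ 2)))) * (1 + u ^+ 2)
      = 1 + u ^+ 2 + h ^+ 2 * (1 + u ^+ 2) - 2 * h * u.
      by field; rewrite gt_eqF.
    by have := sqr_ge0 (h * u); nra.
  rewrite -[X in X <= _]expR0 ler_expR big_split/= sumr_const card_ord.
  by rewrite sumrN -mulr_sumr -/S -[h ^+ 2 *+ _]mulr_natl.
have n0 : 0 < n.+1%:R :> R by rewrite ltr0n.
(* This [h] minimizes the quadratic, whose value there is negative unless [S] vanishes. *)
have := key (S / n.+1%:R).
have -> : n.+1%:R * (S / n.+1%:R) ^+ 2 - 2 * (S / n.+1%:R) * S = - (S ^+ 2 / n.+1%:R).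
  by field; rewrite gt_eqF.
rewrite oppr_ge0 pmulr_lle0 ?invr_gt0// => S2.
by apply/eqP; rewrite -sqrf_eq0 eq_le S2 sqr_ge0.
Qed.

(** Taylor remainders are averaged over the sample, and the score equation removes the terms at
    [z i - e]. [J] is arbitrary here; it is added and subtracted so that the curvature enters only
    through its deviation from [J]. *)
Lemma score_expansion n (z : nat -> R) e (J : R) : (0 < n)%N ->
  (forall t, \prod_(i < n) (1 + (z i - e) ^+ 2) <= \prod_(i < n) (1 + (z i - t) ^+ 2)) ->
  `|J * e - n%:R^-1 * \sum_(i < n) score (z i)
     - e * (n%:R^-1 * \sum_(i < n) (J - dscore (z i)))| <= 2 * e ^+ 2.
Proof.
move=> n0 /score_eq0 S0; have n0' : 0 < n%:R :> R by rewrite ltr0n.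
have -> : J * e - n%:R^-1 * \sum_(i < n) score (z i)
     - e * (n%:R^-1 * \sum_(i < n) (J - dscore (z i))) =
  n%:R^-1 * \sum_(i < n) (score (z i - e) - score (z i) + e * dscore (z i)).
  rewrite !big_split/= S0 -mulr_sumr !sumrN sumr_const card_ord -mulr_natl.
  by field; rewrite gt_eqF.
rewrite normrM normfV (gtr0_norm n0') mulrC ler_pdivrMr//.
rewrite (le_trans (ler_norm_sum _ _ _))//.
rewrite (_ : 2 * e ^+ 2 * n%:R = \sum_(i < n) (2 * e ^+ 2)).
  by apply: ler_sum => i _; exact: score_taylor.
by rewrite sumr_const card_ord -[RHS]mulr_natr.
Qed.

(* Below the threshold [J * eta ^+ 2 / 20] the linear term [J * e] dominates the
   remainders, so that [e] is controlled by [A] unless [D] is itself large. *)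
Lemma sqr_error_bound (J e A D eta : R) : 0 < J <= 1 -> 0 < eta <= 1 ->
  `|D| <= 2 -> `|J * e - A - e * D| <= 2 * e ^+ 2 ->
  `|J ^+ 2 * e ^+ 2 - A ^+ 2| <= 2 * eta * A ^+ 2 + 5 * eta * D ^+ 2
     + 20 / eta ^+ 3 * (if J * eta ^+ 2 / 20 < `|e| then e ^+ 4 else 0).
Proof.
move=> /andP[J0 J1] /andP[h0 h1] D2 H.
have h3 : 0 < eta ^+ 3 by rewrite exprn_gt0.
pose del := J * eta ^+ 2 / 20.
have eta2 : 0 < eta ^+ 2 <= 1 by rewrite exprn_gt0//= expr_le1// ltW.
have del0 : 0 < del by rewrite /del; nra.
have delJ : del <= J / 20 by rewrite /del; nra.
have D4 : D ^+ 4 <= 4 * D ^+ 2.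
  have : D ^+ 2 <= 4.
    by rewrite -(@real_normK _ D) ?num_real//; have := normr_ge0 D; nra.
  rewrite (_ : D ^+ 4 = D ^+ 2 * D ^+ 2); last by ring.
  by have := sqr_ge0 D; nra.
have [Q QE] : exists Q, Q = J * e - A by eexists.
rewrite -QE in H.
have Q2 : Q ^+ 2 <= 2 * e ^+ 2 * D ^+ 2 + 8 * e ^+ 4.
  move: H; rewrite ler_norml => /andP[Ha Hb].
  have : (Q - e * D) ^+ 2 <= 4 * e ^+ 4.
    rewrite (_ : 4 * e ^+ 4 = (2 * e ^+ 2) ^+ 2); last by ring.
    rewrite -(@real_normK _ (Q - e * D)) ?num_real// ler_sqr ?nnegrE//;
      last by rewrite mulr_ge0// sqr_ge0.
    by rewrite ler_norml Ha Hb.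
  have := sqr_ge0 (Q - e * D - e * D).
  rewrite (_ : (Q - e * D - e * D) ^+ 2 =
    2 * (Q - e * D) ^+ 2 + 2 * e ^+ 2 * D ^+ 2 - Q ^+ 2); last by ring.
  lra.
(* Young's inequality with weight [eta] for the cross term [2 * A * Q]. *)
have step1 : `|J ^+ 2 * e ^+ 2 - A ^+ 2| <= eta * A ^+ 2 + (1 + eta^-1) * Q ^+ 2.
  rewrite (_ : J ^+ 2 * e ^+ 2 - A ^+ 2 = Q ^+ 2 + 2 * A * Q); last by rewrite QE; ring.
  have E1 : eta * A ^+ 2 + eta^-1 * Q ^+ 2 - 2 * A * Q = eta^-1 * (eta * A - Q) ^+ 2.
    by field; rewrite gt_eqF.
  have E2 : eta * A ^+ 2 + eta^-1 * Q ^+ 2 + 2 * A * Q = eta^-1 * (eta * A + Q) ^+ 2.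
    by field; rewrite gt_eqF.
  have F1 : 0 <= eta^-1 * (eta * A - Q) ^+ 2 by rewrite mulr_ge0 ?sqr_ge0 ?invr_ge0 ?ltW.
  have F2 : 0 <= eta^-1 * (eta * A + Q) ^+ 2 by rewrite mulr_ge0 ?sqr_ge0 ?invr_ge0 ?ltW.
  rewrite -E1 in F1; rewrite -E2 in F2; have Q0 := sqr_ge0 Q.
  by rewrite ler_norml; apply/andP; split; lra.
have V1 : 1 <= eta^-1 by rewrite invf_ge1.
have e4 : 0 <= e ^+ 4 by rewrite exprn_even_ge0.
have step2 : (1 + eta^-1) * Q ^+ 2 <= 4 * eta * D ^+ 2 + 20 / eta ^+ 3 * e ^+ 4.
  have : (1 + eta^-1) * Q ^+ 2 <= 2 * eta^-1 * (2 * e ^+ 2 * D ^+ 2 + 8 * e ^+ 4).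
    by apply: ler_pM; rewrite ?sqr_ge0//; lra.
  move=> /le_trans; apply.
  (* Young's inequality again, for the mixed term; it contributes 4 to the coefficient of
     [e ^+ 4 / eta ^+ 3] and the pure fourth power contributes 16, hence 20. *)
  have : 4 * e ^+ 2 * D ^+ 2 / eta <= eta * D ^+ 4 + 4 / eta ^+ 3 * e ^+ 4.
    rewrite -subr_ge0 (_ : _ - _ = eta * (D ^+ 2 - 2 * e ^+ 2 / eta ^+ 2) ^+ 2).
      by rewrite mulr_ge0 ?sqr_ge0 ?ltW.
    by field; rewrite gt_eqF.
  have : 16 / eta * e ^+ 4 <= 16 / eta ^+ 3 * e ^+ 4.
    apply: ler_wpM2r => //; apply: ler_wpM2l => //.
    rewrite lef_pV2 ?posrE//; nra.
  have : eta * D ^+ 4 <= eta * (4 * D ^+ 2) by rewrite ler_pM2l.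
  rewrite (_ : 2 * eta^-1 * _ = 4 * e ^+ 2 * D ^+ 2 / eta + 16 / eta * e ^+ 4); last by ring.
  rewrite (_ : 20 / eta ^+ 3 * e ^+ 4 =
    4 / eta ^+ 3 * e ^+ 4 + 16 / eta ^+ 3 * e ^+ 4); last by ring.
  lra.
(* Beyond the threshold the last term is the left side itself; below it, [e ^+ 4] must be absorbed
   by [A] and [D]. *)
have step3 : 20 / eta ^+ 3 * e ^+ 4 <= eta * A ^+ 2 + eta * D ^+ 2 +
    20 / eta ^+ 3 * (if del < `|e| then e ^+ 4 else 0).
  have AD0 : 0 <= eta * A ^+ 2 + eta * D ^+ 2.
    by rewrite addr_ge0// mulr_ge0 ?sqr_ge0// ltW.
  case: ltP => [_|ed]; first by lra.
  rewrite mulr0 addr0 -mulrDr.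
  rewrite -ler_pdivlMl; last by rewrite divr_gt0.
  rewrite (_ : (20 / eta ^+ 3)^-1 * _ = eta ^+ 4 / 20 * (A ^+ 2 + D ^+ 2)); last first.
    by field; rewrite gt_eqF.
  (* The 20 in the threshold serves here: the left side is [eta ^+ 4 / 25]. *)
  have dd : del ^+ 2 * 16 / J ^+ 2 <= eta ^+ 4 / 20.
    rewrite (_ : _ / J ^+ 2 = 16 / 400 * eta ^+ 4).
      by have := exprn_even_ge0 eta (isT : ~~ odd 4); lra.
    by rewrite /del; field; rewrite gt_eqF.
  have e2d : e ^+ 2 <= del ^+ 2.
    by rewrite -(@real_normK _ e) ?num_real// ler_sqr ?nnegrE// ltW.
  suff : e ^+ 4 <= del ^+ 2 * 16 / J ^+ 2 * (A ^+ 2 + D ^+ 2).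
    by move=> /le_trans; apply; rewrite ler_wpM2r// addr_ge0 ?sqr_ge0.
  rewrite (_ : e ^+ 4 = e ^+ 2 * e ^+ 2); last by ring.
  rewrite (_ : _ * (A ^+ 2 + _) = del ^+ 2 * (16 / J ^+ 2 * (A ^+ 2 + D ^+ 2))); last by ring.
  apply: ler_pM => //; rewrite ?sqr_ge0// mulrAC ler_pdivlMr ?exprn_gt0//.
  rewrite -exprMn; have A2 := sqr_ge0 A; have DD := sqr_ge0 D.
  (* If [D] is small, the terms in [e * D] and [e ^+ 2] cost less than half of [J * e] in absolute
     value, so [A] controls [e]. Otherwise [D ^+ 2] is at least [J ^+ 2 / 16], and [e ^+ 2 <= 1] is
     enough. *)
  have [DJ|DJ] := leP `|D| (J / 4).
    suff : (e * J) ^+ 2 <= (2 * `|A|) ^+ 2.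
      by move=> /le_trans; apply; rewrite exprMn real_normK ?num_real//; lra.
    rewrite -(@real_normK _ (e * J)) ?num_real// ler_sqr ?nnegrE//.
    rewrite normrM (gtr0_norm J0).
    have : J * `|e| <= `|A| + `|e| * `|D| + 2 * `|e| ^+ 2.
      rewrite real_normK ?num_real// -{1}(gtr0_norm J0) -!normrM.
      rewrite (_ : J * e = A + e * D + (Q - e * D)); last by rewrite QE; ring.
      by rewrite (le_trans (ler_normD _ _))// lerD// ler_normD.
    have := normr_ge0 e; have := normr_ge0 A; nra.
  have : (J / 4) ^+ 2 <= D ^+ 2.
    by rewrite -(@real_normK _ D) ?num_real// ler_sqr ?nnegrE// ltW//; lra.
  rewrite exprMn; have : e ^+ 2 <= 1 by nra.
  by have := sqr_ge0 J; have := sqr_ge0 e; nra.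
rewrite -/del; lra.
Qed.

End deterministic.

(** * Integrals of powers of 1 + x^2 *)

Section integrals.
Context {R : realType}.
Local Notation mu := (@lebesgue_measure R).
Implicit Types (p x t : R) (n : nat).

Lemma is_derive_powq p x :
  is_derive x 1 (fun y : R => (1 + y ^+ 2) `^ p) (2 * p * x * (1 + x ^+ 2) `^ (p - 1)).
Proof.
have h : is_derive x 1 (fun y : R => 1 + y ^+ 2) (2 * x).
  by apply: is_derive_eq; rewrite /GRing.scale/=; ring.
have := @is_derive1_comp R (@powR R ^~ p) (fun y => 1 + y ^+ 2) x _ _
  (is_derive1_powR p (sqrp1_gt0 x)) h.
by move=> /is_derive_eq; apply; ring.
Qed.

Lemma continuous_powq p : continuous (fun x : R => (1 + x ^+ 2) `^ p).
Proof.
move=> x; apply: differentiable_continuous; apply/derivable1_diffP.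
by have [] := is_derive_powq p x.
Qed.

Lemma measurable_powq p t : measurable_fun setT (fun x : R => (1 + (x - t) ^+ 2) `^ p).
Proof.
apply: continuous_measurable_fun => x.
apply: (@continuous_comp _ _ _ (fun y => y - t) (fun y => (1 + y ^+ 2) `^ p)).
  by apply: cvgB; [exact: cvg_id|exact: cvg_cst].
exact: continuous_powq.
Qed.

Lemma integral_derive (f F : R -> R) (a b : R) : (a < b)%R ->
  continuous f -> (forall x, is_derive x 1 F (f x)) ->
  (\int[mu]_(x in `[a, b]) (f x)%:E = (F b - F a)%:E)%E.
Proof.
move=> ab cf dF; rewrite EFinB; apply: continuous_FTC2 => //.
- exact: continuous_subspaceT.
- have cF x : {for x, continuous F}.
    by apply: differentiable_continuous; apply/derivable1_diffP; have [] := dF x.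
  split.
  + by move=> x _; have [] := dF x.
  + by apply: cvg_at_right_filter; exact: cF.
  + by apply: cvg_at_left_filter; exact: cF.
- by move=> x _; rewrite derive1E; have [_ ->] := dF x.
Qed.

Lemma powqS p x : (1 + x ^+ 2) * (1 + x ^+ 2) `^ (- (p + 1)) = (1 + x ^+ 2) `^ (- p).
Proof.
have q0 := sqrp1_gt0 x.
rewrite -{1}[1 + x ^+ 2]powRr1 ?ltW// -powRD; last by rewrite (gt_eqF q0) implybT.
by congr (_ `^ _); ring.
Qed.

(** Substituting x^2 = (1 + x^2) - 1 leaves two consecutive exponents, so integrating this
    derivative gives a recursion in [p]. *)
Lemma is_derive_xpowq p x : is_derive x 1 (fun y : R => y * (1 + y ^+ 2) `^ (- p))
  ((1 - 2 * p) * (1 + x ^+ 2) `^ (- p) + 2 * p * (1 + x ^+ 2) `^ (- (p + 1))).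
Proof.
have H := is_derive_powq (- p) x.
have := is_deriveM (is_derive_id x (1 : R)) H.
move=> /is_derive_eq; apply; rewrite /GRing.scale/= -powqS.
by rewrite (_ : - p - 1 = - (p + 1)); ring.
Qed.

Lemma continuous_integrable_itv (f : R -> R) (a b : R) : continuous f ->
  mu.-integrable `[a, b] (EFin \o f).
Proof.
move=> cf; apply: continuous_compact_integrable; first exact: segment_compact.
exact: continuous_subspaceT.
Qed.

Definition powq_itv n p := \int[mu]_(x in `[- n%:R, n%:R]) (1 + x ^+ 2) `^ (- p).

Lemma powq_itv_rec n p : (0 < n)%N ->
  (1 - 2 * p) * powq_itv n p + 2 * p * powq_itv n (p + 1) =
  2 * (n%:R * (1 + n%:R ^+ 2) `^ (- p)).
Proof.
move=> n0; have n0' : 0 < n%:R :> R by rewrite ltr0n.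
have ci q : mu.-integrable `[- n%:R, n%:R] (EFin \o (fun x : R => (1 + x ^+ 2) `^ q)).
  by apply: continuous_integrable_itv; exact: continuous_powq.
have H ab cf := @integral_derive _ _ (- n%:R) n%:R ab cf (is_derive_xpowq p).
have {H} : \int[mu]_(x in `[- n%:R, n%:R]) ((1 - 2 * p) * (1 + x ^+ 2) `^ (- p) +
    2 * p * (1 + x ^+ 2) `^ (- (p + 1))) = 2 * (n%:R * (1 + n%:R ^+ 2) `^ (- p)).
  rewrite /Rintegral H/= ?gtrN//; first by rewrite sqrrN; ring.
  move=> x; apply: cvgD; (apply: cvgM; first exact: cvg_cst); exact: continuous_powq.
rewrite RintegralD//=.
- by rewrite !RintegralZl.
- by apply: continuous_integrable_itv => x; apply: cvgM;
    [exact: cvg_cst|exact: continuous_powq].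
- by apply: continuous_integrable_itv => x; apply: cvgM;
    [exact: cvg_cst|exact: continuous_powq].
Qed.

Lemma powq_itv_ge0 n p : 0 <= powq_itv n p.
Proof. by apply: Rintegral_ge0 => x _; exact: powR_ge0. Qed.

(** The recursion bounds exponent [p] by exponent [p + 1], hence by exponent 3/2, for which the
    recursion at 1/2 degenerates to an explicit value at most 2. The bound is uniform in [n]. *)
Lemma powq_itv_le n p : 1 / 2 < p -> (0 < n)%N -> powq_itv n p <= 4 * p / (2 * p - 1).
Proof.
move=> p2 n0; have d0 : 0 < 2 * p - 1 by lra.
have n0' : 0 < n%:R :> R by rewrite ltr0n.
have q0 := sqrp1_gt0 (n%:R : R).
have h32 : powq_itv n (2^-1 + 1) <= 2.
  have := @powq_itv_rec n 2^-1 n0.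
  rewrite mulfV// subrr mul0r add0r mul1r => ->.
  rewrite ler_piMr// powRN ler_pdivrMr ?powR_gt0// mul1r powR12_sqrt ?(ltW q0)//.
  by rewrite -[leLHS]ger0_norm// -sqrtr_sqr ler_sqrt ?lerDr// ltW.
have h1 : powq_itv n (p + 1) <= powq_itv n (2^-1 + 1).
  apply: le_Rintegral => //=.
  - by apply: continuous_integrable_itv; exact: continuous_powq.
  - by apply: continuous_integrable_itv; exact: continuous_powq.
  - by move=> x _; apply: ler_powR; [exact: sqrp1_ge1|lra].
have := @powq_itv_rec n p n0.
have : 0 <= n%:R * (1 + n%:R ^+ 2) `^ (- p) :> R by rewrite mulr_ge0// powR_ge0.
rewrite (ler_pdivlMr _ _ d0); move: {h1 h32}(le_trans h1 h32) (powq_itv_ge0 n (p + 1)).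
move: (powq_itv n p) (powq_itv n (p + 1)) (n%:R * _) => u v w.
nra.
Qed.

Lemma bigcup_itv_sym : \bigcup_n `[- n%:R, n%:R]%classic = [set: R].
Proof.
apply/seteqP; split => // x _.
exists (Num.bound `|x|) => //=; rewrite in_itv/= -ler_norml ltW//.
exact: archi_boundP.
Qed.

Lemma nondecreasing_itv_sym : nondecreasing_seq (fun n => `[- n%:R, n%:R]%classic : set R).
Proof.
move=> i j ij; apply/subsetPset => x /=; rewrite !in_itv/= => /andP[h1 h2].
have : i%:R <= j%:R :> R by rewrite ler_nat.
by move=> ?; apply/andP; split; lra.
Qed.

Definition powq_int p := \int[mu]_x (1 + x ^+ 2) `^ (- p).

Lemma powq_itv_EFin n p :
  (\int[mu]_(x in `[(- n%:R)%R, n%:R%R]) ((1 + x ^+ 2) `^ (- p))%:E)%E = (powq_itv n p)%:E.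
Proof.
rewrite fineK//; apply: integrable_fin_num => //.
by apply: (@continuous_integrable_itv (fun x => (1 + x ^+ 2) `^ (- p))); exact: continuous_powq.
Qed.

Lemma measurable_powq0 p : measurable_fun setT (fun x : R => (1 + x ^+ 2) `^ p).
Proof. by apply: continuous_measurable_fun; exact: continuous_powq. Qed.

Lemma cvge_powq_itv p : (powq_itv n p)%:E @[n --> \oo] -->
  (\int[mu]_x ((1 + x ^+ 2) `^ (- p))%:E)%E.
Proof.
under eq_fun do rewrite -powq_itv_EFin.
rewrite -bigcup_itv_sym; apply: ge0_nondecreasing_set_cvg_integral.
- exact: nondecreasing_itv_sym.
- by move=> i.
- by move=> i; apply/measurable_EFinP; apply: measurable_funTS; exact: measurable_powq0.
- by move=> i x _; rewrite lee_fin powR_ge0.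
Qed.

(** The real-valued [powq_int] would be 0 by convention if the integral diverged; monotone
    convergence and the uniform bound on the truncations exclude this. *)
Lemma powq_int_EFin p : 1 / 2 < p ->
  (\int[mu]_x ((1 + x ^+ 2) `^ (- p))%:E)%E = (powq_int p)%:E.
Proof.
move=> p2; rewrite fineK// ge0_fin_numE; last first.
  by apply: integral_ge0 => x _; rewrite lee_fin powR_ge0.
apply: (@le_lt_trans _ _ (4 * p / (2 * p - 1))%:E); last by rewrite ltry.
apply: (cvge_le _ (@cvge_powq_itv p)).
by near=> n; rewrite lee_fin powq_itv_le//; near: n; exact: nbhs_infty_gt.
Unshelve. all: by end_near. Qed.

Lemma integrable_powq p : 1 / 2 < p ->
  mu.-integrable setT (fun x : R => ((1 + x ^+ 2) `^ (- p))%:E).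
Proof.
move=> p2; apply/integrableP; split.
  by apply/measurable_EFinP; exact: measurable_powq0.
under eq_integral do rewrite gee0_abs ?lee_fin ?powR_ge0//.
by rewrite powq_int_EFin// ltry.
Qed.

(** On [0, 1] the integrand is at least 2^(-p). *)
Lemma powq_int_gt0 p : 1 / 2 < p -> 0 < powq_int p.
Proof.
move=> p2; rewrite -lte_fin -powq_int_EFin//.
apply: (@lt_le_trans _ _ (\int[mu]_(x in `[0%R, 1%R]) (2 `^ (- p))%:E)%E).
  rewrite integral_cst//= lebesgue_measure_itv/= lte_fin ltr01 sube0 mule1.
  by rewrite lte_fin powR_gt0.
rewrite (@le_trans _ _ (\int[mu]_(x in `[0%R, 1%R]) ((1 + x ^+ 2) `^ (- p))%:E)%E)//.
  apply: ge0_le_integral => //.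
  - by apply/measurable_EFinP; apply: measurable_funTS; exact: measurable_powq0.
  - move=> x /=; rewrite in_itv/= => /andP[x0 x1]; rewrite lee_fin !powRN.
    rewrite lef_pV2 ?posrE ?powR_gt0 ?sqrp1_gt0//.
    by apply: ge0_ler_powR; rewrite ?nnegrE ?(ltW (sqrp1_gt0 _))//; [lra|nra].
apply: ge0_subset_integral => //.
- by apply/measurable_EFinP; exact: measurable_powq0.
- by move=> x _; rewrite lee_fin powR_ge0.
Qed.

Lemma cvg_powq_itv p : 1 / 2 < p -> powq_itv n p @[n --> \oo] --> powq_int p.
Proof.
by move=> p2; have := @cvge_powq_itv p; rewrite powq_int_EFin// => /fine_cvg.
Qed.

(** This is the boundary term of the recursion. As n <= (1 + n^2)^(1/2), it is at most (1 +
    n^2)^(1/2 - p), a negative power. *)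
Lemma natr_powq_cvg0 p : 1 / 2 < p ->
  n%:R * (1 + n%:R ^+ 2) `^ (- p) @[n --> \oo] --> (0 : R).
Proof.
move=> p2; apply/cvgrPdist_lt => e e0.
have a0 : 0 < p - 1 / 2 by lra.
near=> n; rewrite sub0r normrN ger0_norm ?mulr_ge0 ?powR_ge0//.
have q0 := sqrp1_gt0 (n%:R : R).
apply: (@le_lt_trans _ _ ((1 + n%:R ^+ 2) `^ (- (p - 1 / 2)))).
  rewrite (_ : - (p - 1 / 2) = 2^-1 - p); last by lra.
  rewrite powRD; last by rewrite (gt_eqF q0) implybT.
  rewrite ler_wpM2r ?powR_ge0// powR12_sqrt ?(ltW q0)//.
  by rewrite -[leLHS]ger0_norm// -sqrtr_sqr ler_sqrt ?lerDr// ltW.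
rewrite powRN -[ltRHS]invrK ltf_pV2 ?posrE ?invr_gt0 ?powR_gt0//.
(* Writing 1/e as a power reduces the claim to (1/e)^(1/(p - 1/2)) < 1 + n^2. *)
have -> : e^-1 = (e^-1 `^ (p - 1 / 2)^-1) `^ (p - 1 / 2).
  by rewrite -powRrM mulVf ?gt_eqF// powRr1// invr_ge0 ltW.
apply: gt0_ltr_powR; rewrite ?nnegrE ?powR_ge0 ?(ltW q0)//.
apply: (@lt_le_trans _ _ n%:R).
  by near: n; exact: nbhs_infty_gtr.
have : 1 <= n%:R :> R by rewrite ler1n; near: n; exact: nbhs_infty_gt.
nra.
Unshelve. all: by end_near. Qed.

(** The recursion survives in the limit without its boundary term. Only ratios of these integrals
    are needed later, so the normalizing constant is never evaluated. *)
Lemma powq_int_rec p : 1 / 2 < p -> 2 * p * powq_int (p + 1) = (2 * p - 1) * powq_int p.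
Proof.
move=> p2; suff : (1 - 2 * p) * powq_int p + 2 * p * powq_int (p + 1) = 0.
  by move: (powq_int p) (powq_int (p + 1)) => u v ?; lra.
have H : (1 - 2 * p) * powq_itv n p + 2 * p * powq_itv n (p + 1) @[n --> \oo] -->
    (1 - 2 * p) * powq_int p + 2 * p * powq_int (p + 1).
  apply: cvgD; apply: cvgM; try exact: cvg_cst; apply: cvg_powq_itv => //; lra.
have H0 : (1 - 2 * p) * powq_itv n p + 2 * p * powq_itv n (p + 1) @[n --> \oo] --> (0 : R).
  have : 2 * (n%:R * (1 + n%:R ^+ 2) `^ (- p)) @[n --> \oo] --> (0 : R).
    by rewrite -[X in _ --> X](mulr0 2); apply: cvgM; [exact: cvg_cst|exact: natr_powq_cvg0].
  apply: cvg_trans; apply: near_eq_cvg; near=> n; rewrite powq_itv_rec//.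
  by near: n; exact: nbhs_infty_gt.
have <- := cvg_lim _ H; last by [].
exact: cvg_lim.
Unshelve. all: by end_near. Qed.

(** The image of Lebesgue measure under a translation agrees with it on half-open intervals, hence
    everywhere by uniqueness. *)
Lemma lebesgue_integral_shift (f : R -> \bar R) t :
  measurable_fun setT f -> (forall x, 0 <= f x)%E ->
  (\int[mu]_x f (x - t)%R = \int[mu]_x f x)%E.
Proof.
move=> mf f0.
have ms : measurable_fun setT (fun x : measurableTypeR R => x - t : measurableTypeR R).
  by apply: measurable_funB.
rewrite -[LHS](@ge0_integral_pushforward _ _ _ _ _ _ ms mu setT f)//.
apply: eq_measure_integral => A mA _; apply/esym.
apply: lebesgue_measure_unique => // _ [[a b]] _ <-.
transitivity (mu `](a + t)%R, (b + t)%R]%classic).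
  rewrite !lebesgue_measure_itv/= !lte_fin ltrD2r.
  by case: ifPn => // _; rewrite -!EFinB; congr EFin; ring.
rewrite /= /pushforward; congr (mu _); apply/seteqP; split => x /=;
  by rewrite !in_itv/= => /andP[h1 h2]; apply/andP; split; lra.
Qed.

Lemma lebesgue_integral_opp (f : R -> \bar R) :
  measurable_fun setT f -> (forall x, 0 <= f x)%E ->
  (\int[mu]_x f (- x)%R = \int[mu]_x f x)%E.
Proof.
move=> mf f0.
have mo : measurable_fun setT (-%R : measurableTypeR R -> measurableTypeR R).
  exact: oppr_measurable.
rewrite -[LHS](@ge0_integral_pushforward _ _ _ _ _ _ mo mu setT f)//.
by apply: eq_measure_integral => A mA _; exact: lebesgue_measureN.
Qed.

End integrals.

(** * Independence and the sample law *)

Section transfer.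
Local Open Scope ereal_scope.
Context (R : realType).

Import HBNNSimple.

(** Through simple approximations of [g], the right-hand side sees [Y] and [G] only in the integrals
    of [G] over preimages under [Y]. *)
Lemma ge0_integral_comp_lim d (T : measurableType d)
    (mu : {measure set T -> \bar R}) (Y : T -> R) (G : T -> \bar R)
    (g : R -> \bar R) (mg : measurable_fun setT g) :
  measurable_fun setT Y -> measurable_fun setT G -> (forall x, 0 <= G x) ->
  (forall x, 0 <= g x) ->
  \int[mu]_x (g (Y x) * G x) = limn (fun n =>
    \sum_(k \in range (nnsfun_approx measurableT mg n)) (k%:E *
       \int[mu]_(x in Y @^-1` (nnsfun_approx measurableT mg n @^-1` [set k])) G x)).
Proof.
move=> mY mG G0 g0; pose g_ := nnsfun_approx measurableT mg.
have mgY n : measurable_fun setT (fun x => (g_ n (Y x))%:E).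
  by apply/measurable_EFinP; apply: measurableT_comp.
transitivity (limn (fun n => \int[mu]_x ((g_ n (Y x))%:E * G x))).
  rewrite -monotone_convergence//.
  - apply: eq_integral => x _; apply/esym/cvg_lim => //.
    have cg : EFin \o g_ ^~ (Y x) @ \oo --> g (Y x) by exact: cvg_nnsfun_approx.
    have [G00|G00] := eqVneq (G x) 0.
      by rewrite G00; under eq_fun do rewrite mule0; rewrite mule0; exact: cvg_cst.
    case: (G x) (G0 x) G00 => [r| |]// r0 rn0.
      by under eq_fun do rewrite muleC; rewrite muleC; exact: cvgeZl.
    (* There remains [G x] = +oo, where multiplication is discontinuous at 0: either all
       approximants vanish at [Y x] and so does [g], or they are eventually positive and the
       products are infinite. *)
    have ndg : nondecreasing_seq (EFin \o g_ ^~ (Y x)).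
      by move=> i j ij; rewrite lee_fin; exact/lefP/nd_nnsfun_approx.
    have [gall|/existsNP[N gN]] := pselect (forall n, g_ n (Y x) = 0%R).
      have -> : g (Y x) = 0.
        rewrite -(cvg_lim _ cg)// -[RHS](@lim_cst _ _ _ \oo)//; congr (limn _).
        by apply/funext => n /=; rewrite gall.
      by under eq_fun do rewrite gall mul0e; rewrite mul0e; exact: cvg_cst.
    have pos n : (N <= n)%N -> 0 < (g_ n (Y x))%:E.
      move=> Nn; apply: (lt_le_trans _ (ndg _ _ Nn)).
      by rewrite lte_fin lt_neqAle eq_sym; apply/andP; split => //; exact/eqP.
    have gp : 0 < g (Y x).
      apply: (lt_le_trans (pos N (leqnn N))).
      rewrite -(cvg_lim _ cg)//; move: (ereal_nondecreasing_cvgn ndg) => /cvg_lim ->//.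
      by apply: ereal_sup_ubound; exists N.
    rewrite gt0_muley//; apply: cvg_near_cst; exists N => // n /= Nn.
    by rewrite gt0_muley// pos.
  - by move=> n; apply: emeasurable_funM.
  - by move=> n x _; rewrite mule_ge0// lee_fin.
  - move=> x _ i j ij; apply: lee_wpmul2r => //.
    by rewrite lee_fin; exact/lefP/nd_nnsfun_approx.
congr (limn _); apply/funext => n.
have mA k : measurable (Y @^-1` (g_ n @^-1` [set k])).
  by rewrite -[X in measurable X]setTI; apply: mY.
under eq_integral.
  move=> x _; rewrite fimfunE -fsumEFin// ge0_mule_fsuml; last first.
    by move=> k; rewrite nnfun_muleindic_ge0.
  over.
rewrite ge0_integral_fsum//; last 2 first.
- move=> k; apply: emeasurable_funM => //; apply/measurable_EFinP.
  apply: measurable_funM => //; exact: measurable_indic (mA k).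
- by move=> k x _; rewrite mule_ge0// nnfun_muleindic_ge0.
apply: eq_fsbigr => k /set_mem[y _ <-].
rewrite -[RHS](ge0_integralZl mu (mA _) (measurable_funTS mG))//; last by rewrite lee_fin.
rewrite [RHS]integral_mkcond; apply: eq_integral => x _.
rewrite patchE EFinM indicE -muleA.
have -> : (Y x \in g_ n @^-1` [set g_ n y]) = (x \in Y @^-1` (g_ n @^-1` [set g_ n y])) by [].
by case: (x \in _) => /=; rewrite ?mul1e ?mul0e ?mule0.
Qed.

(** A substitution rule with two uses: when [G2] is a density it computes expectations under the law
    of an observation, and when [G2] is constant it splits off an independent variable. *)
Lemma ge0_integral_transfer d1 d2 (T1 : measurableType d1)
    (T2 : measurableType d2) (mu1 : {measure set T1 -> \bar R})
    (mu2 : {measure set T2 -> \bar R}) (Y1 : T1 -> R) (Y2 : T2 -> R)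
    (G1 : T1 -> \bar R) (G2 : T2 -> \bar R) (g : R -> \bar R) :
  measurable_fun setT Y1 -> measurable_fun setT Y2 ->
  measurable_fun setT G1 -> measurable_fun setT G2 ->
  (forall x, 0 <= G1 x) -> (forall x, 0 <= G2 x) ->
  (forall A, measurable A ->
    \int[mu1]_(x in Y1 @^-1` A) G1 x = \int[mu2]_(x in Y2 @^-1` A) G2 x) ->
  measurable_fun setT g -> (forall x, 0 <= g x) ->
  \int[mu1]_x (g (Y1 x) * G1 x) = \int[mu2]_x (g (Y2 x) * G2 x).
Proof.
move=> mY1 mY2 mG1 mG2 G10 G20 H mg g0.
rewrite !(ge0_integral_comp_lim _ mg)//; congr (limn _); apply/funext => n.
by apply: eq_fsbigr => k _; rewrite H.
Qed.

End transfer.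

Section independence.
Local Open Scope ereal_scope.
Context (R : realType) d (T : measurableType d) (P : probability T R)
  (X : nat -> T -> R) (mX : forall i, measurable_fun setT (X i))
  (hind : mutually_independent P X).

Lemma measurable_bigsetI_preimage (s : seq nat) (A : nat -> set R) :
  (forall i, measurable (A i)) ->
  measurable (\big[setI/setT]_(i <- s) (X i @^-1` A i)).
Proof.
move=> mA; apply: bigsetI_measurable => i _.
by rewrite -[Y in measurable Y]setTI; exact: mX.
Qed.

(** Functions on [s1] and events on [s2] are mixed so that an induction can turn events into
    functions one index at a time; for empty [s1] this is the definition of independence. *)
Lemma independent_integral_prod_setI (g : nat -> R -> R) (s1 s2 : seq nat)
    (A : nat -> set R) :
  (forall i, measurable_fun setT (g i)) -> (forall i x, 0 <= g i x)%R ->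
  uniq (s1 ++ s2) -> (forall i, measurable (A i)) ->
  \int[P]_(w in \big[setI/setT]_(i <- s2) (X i @^-1` A i))
     (\prod_(i <- s1) g i (X i w))%R%:E =
  (\prod_(i <- s1) \int[P]_w (g i (X i w))%:E) * \prod_(i <- s2) P (X i @^-1` A i).
Proof.
move=> mg g0; elim: s1 s2 A => [|i s1 IH] s2 A us mA.
  have mB := measurable_bigsetI_preimage s2 mA.
  under eq_integral do rewrite big_nil.
  by rewrite integral_cst// mul1e big_nil mul1e; exact: hind.
set B := \big[setI/setT]_(j <- s2) _.
have mB : measurable B by exact: measurable_bigsetI_preimage.
pose G (w : T) : \bar R := (\prod_(j <- s1) g j (X j w))%R%:E.
have mG : measurable_fun setT G.
  apply/measurable_EFinP; apply: measurable_prod => j _.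
  exact: measurableT_comp (mX j).
have G0 w : 0 <= G w by rewrite lee_fin prodr_ge0.
pose c := (\prod_(j <- s1) \int[P]_w (g j (X j w))%:E) * \prod_(j <- s2) P (X j @^-1` A j).
have c0 : 0 <= c.
  rewrite mule_ge0// prode_ge0// => j _; apply: integral_ge0 => w _.
  by rewrite lee_fin.
rewrite integral_mkcond.
transitivity (\int[P]_w ((g i (X i w))%:E * (G \_ B) w)).
  apply: eq_integral => w _; rewrite !patchE; case: ifPn => // _.
    by rewrite big_cons EFinM.
  by rewrite mule0.
rewrite (@ge0_integral_transfer _ _ _ _ _ P P (X i) (X i) (G \_ B) (cst c)
  (fun x => (g i x)%:E))//.
- rewrite ge0_integralZr//.
  + by rewrite big_cons -muleA.
  + by apply/measurable_EFinP; exact: measurableT_comp (mX i).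
  + by move=> w _; rewrite lee_fin.
- apply/(measurable_restrictT _ _).1 => //; exact: measurable_funTS.
- by move=> w; apply: erestrict_ge0.
- move=> A' mA'; rewrite integral_cst//; last first.
    by rewrite -[Y in measurable Y]setTI; exact: mX.
  rewrite -integral_mkcondr.
  have us' : uniq (s1 ++ i :: s2) by rewrite -(cat1s i s2) uniq_catCA.
  (* Index [i] receives the new event [A']; as [i] is not in [s2], the other events are unchanged
     and the induction hypothesis applies to [i :: s2]. *)
  pose A2 j := if j == i then A' else A j.
  have ni : i \notin s2.
    by move: us; rewrite /= mem_cat negb_or => /andP[/andP[]].
  have bigA2 : \big[setI/setT]_(j <- s2) (X j @^-1` A2 j) = B.
    apply: eq_big_seq => j js2; rewrite /A2; case: eqP => // ji.
    by move: ni; rewrite -ji js2.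
  have prodA2 : \prod_(j <- s2) P (X j @^-1` A2 j) = \prod_(j <- s2) P (X j @^-1` A j).
    apply: eq_big_seq => j js2; rewrite /A2; case: eqP => // ji.
    by move: ni; rewrite -ji js2.
  have := IH (i :: s2) A2 us'.
  have A2i : A2 i = A' by rewrite /A2 eqxx.
  rewrite !big_cons bigA2 prodA2 !A2i => ->.
    by rewrite /c muleCA muleC.
  by move=> j; rewrite /A2; case: ifP.
- by apply/measurable_EFinP.
- by move=> x; rewrite lee_fin.
Qed.

Lemma independent_integral_prod (g : nat -> R -> R) (s : seq nat) :
  (forall i, measurable_fun setT (g i)) -> (forall i x, 0 <= g i x)%R -> uniq s ->
  \int[P]_w (\prod_(i <- s) g i (X i w))%R%:E =
  \prod_(i <- s) \int[P]_w (g i (X i w))%:E.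
Proof.
move=> mg g0 us; have := @independent_integral_prod_setI g s [::] (fun=> setT) mg g0.
by rewrite cats0 !big_nil mule1; apply.
Qed.

End independence.

(** * Bounded random variables *)

Section bounded.
Context (R : realType) d (T : measurableType d) (P : probability T R).
Implicit Types f g : T -> R.

Definition bounded_measurable f :=
  measurable_fun setT f /\ exists M, forall w, `|f w| <= M.

Lemma bounded_measurable_integrable f : bounded_measurable f ->
  P.-integrable setT (EFin \o f).
Proof.
move=> [mf [M fM]]; apply: (@le_integrable _ _ _ P _ measurableT _ (EFin \o cst M)).
- exact/measurable_EFinP.
- by move=> w _ /=; rewrite lee_fin (le_trans (fM w))// ler_norm.
- exact: finite_measure_integrable_cst.
Qed.

Lemma bounded_measurable_cst (c : R) : bounded_measurable (cst c).
Proof. by split; [exact: measurable_cst|exists `|c|]. Qed.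

Lemma bounded_measurableD f g : bounded_measurable f -> bounded_measurable g ->
  bounded_measurable (fun w => f w + g w).
Proof.
move=> [mf [M fM]] [mg [N gN]]; split; first exact: measurable_funD.
by exists (M + N) => w; rewrite (le_trans (ler_normD _ _))// lerD.
Qed.

Lemma bounded_measurableM f g : bounded_measurable f -> bounded_measurable g ->
  bounded_measurable (fun w => f w * g w).
Proof.
move=> [mf [M fM]] [mg [N gN]]; split; first exact: measurable_funM.
by exists (M * N) => w; rewrite normrM ler_pM.
Qed.

Lemma bounded_measurable_sum (I : Type) (s : seq I) (F : I -> T -> R) :
  (forall i, bounded_measurable (F i)) ->
  bounded_measurable (fun w => \sum_(i <- s) F i w).
Proof.
move=> bF; elim: s => [|i s IH].
  by under eq_fun do rewrite big_nil; exact: bounded_measurable_cst.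
by under eq_fun do rewrite big_cons; exact: bounded_measurableD.
Qed.

Lemma Rintegral_EFin f : bounded_measurable f ->
  (\int[P]_w (f w)%:E)%E = (\int[P]_w f w)%:E.
Proof.
move=> bf; rewrite fineK//; apply: integrable_fin_num => //.
exact: bounded_measurable_integrable.
Qed.

Lemma Rintegral_probability_cst (c : R) : \int[P]_w c = c.
Proof. by rewrite Rintegral_cst//= probability_setT mulr1. Qed.

Lemma Rintegral_sum (I : Type) (s : seq I) (F : I -> T -> R) :
  (forall i, bounded_measurable (F i)) ->
  \int[P]_w (\sum_(i <- s) F i w) = \sum_(i <- s) \int[P]_w F i w.
Proof.
move=> bF; elim: s => [|i s IH].
  by under eq_Rintegral do rewrite big_nil; rewrite big_nil Rintegral_probability_cst.
under eq_Rintegral do rewrite big_cons; rewrite big_cons RintegralD// ?IH//.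
- exact: bounded_measurable_integrable.
- by apply: bounded_measurable_integrable; exact: bounded_measurable_sum.
Qed.

End bounded.

(** * Expectations over the sample *)

Section sample.
Context (R : realType) (m : R) (hm : 1 / 2 < m) (theta : R)
  (d : measure_display) (T : measurableType d) (P : probability T R)
  (X : nat -> T -> R) (hlaw : forall i : nat, has_law_PVII P m theta (X i))
  (hind : mutually_independent P X).
Local Notation mu := (@lebesgue_measure R).
Local Notation Z := (fun i w => X i w - theta).

Lemma pvii_cE : pvii_c m = (powq_int m)^-1.
Proof. by []. Qed.

Lemma pvii_c_gt0 : 0 < pvii_c m.
Proof. by rewrite pvii_cE invr_gt0 powq_int_gt0. Qed.

Lemma pvii_f_gt0 x : 0 < pvii_f m x.
Proof. by rewrite mulr_gt0 ?pvii_c_gt0// powR_gt0 ?sqrp1_gt0. Qed.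

Lemma measurable_pvii_f : measurable_fun setT (pvii_f m).
Proof. by apply: measurable_funM => //; exact: measurable_powq0. Qed.

Lemma integrable_pvii_f : mu.-integrable setT (EFin \o pvii_f m).
Proof. exact: (integrableZl measurableT _ (integrable_powq hm)). Qed.

Lemma Rintegral_pvii_f : \int[mu]_x pvii_f m x = 1.
Proof.
rewrite RintegralZl//; last exact: integrable_powq.
by rewrite pvii_cE mulVf// gt_eqF// powq_int_gt0.
Qed.

Lemma measurable_sample i : measurable_fun setT (Z i).
Proof. by apply: measurable_funB => //; have [] := hlaw i. Qed.

Lemma sample_law_ge0 i (g : R -> R) : measurable_fun setT g -> (forall x, 0 <= g x) ->
  (\int[P]_w (g (Z i w))%:E = \int[mu]_x (g x * pvii_f m x)%:E)%E.
Proof.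
move=> mg g0; have [mX lawX] := hlaw i.
have mshift : measurable_fun setT (fun x : R => x - theta) by exact: measurable_funB.
have mf : measurable_fun setT (fun x : R => pvii_f m (x - theta)).
  exact: measurableT_comp measurable_pvii_f mshift.
transitivity (\int[P]_w ((g (Z i w))%:E * cst 1 w))%E.
  by apply: eq_integral => w _; rewrite mule1.
have f0 x : (0 <= (pvii_f m (x - theta))%:E)%E by rewrite lee_fin ltW// pvii_f_gt0.
have lawZ A : measurable A -> (\int[P]_(w in Z i @^-1` A) cst 1 w =
    \int[mu]_(x in (fun x => x - theta)%R @^-1` A) (pvii_f m (x - theta))%:E)%E.
  move=> mA; have mA' : measurable ((fun x : R => x - theta) @^-1` A).
    by rewrite -[Y in measurable Y]setTI; exact: mshift.
  rewrite -(lawX _ mA') integral_cst ?mul1e//.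
  by rewrite -[Y in measurable Y]setTI; exact: measurable_sample.
(* Lebesgue measure weighted by the translated density replaces [P]; a translation by [theta] then
   centers it. *)
have H := @ge0_integral_transfer _ _ _ _ _ P mu (Z i) (fun x => x - theta) (cst 1%E)
  (fun x => (pvii_f m (x - theta))%:E) (fun x => (g x)%:E) (measurable_sample i) mshift
  (@measurable_cst _ _ _ _ _ _) (iffRL (measurable_EFinP _ _) mf) (fun=> lee01) f0 lawZ
  (iffRL (measurable_EFinP _ _) mg) (fun x => g0 x).
rewrite {}H -[RHS](@lebesgue_integral_shift _ (fun x => (g x * pvii_f m x)%:E) theta).
- by apply: eq_integral => x _; rewrite EFinM.
- by apply/measurable_EFinP; apply: measurable_funM => //; exact: measurable_pvii_f.
- by move=> x; rewrite lee_fin mulr_ge0// ltW// pvii_f_gt0.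
Qed.

Lemma integrable_bounded_pvii (g : R -> R) (M : R) : measurable_fun setT g ->
  (forall x, `|g x| <= M) -> mu.-integrable setT (EFin \o (fun x => g x * pvii_f m x)).
Proof.
move=> mg gM.
have iM := integrableZl measurableT M integrable_pvii_f.
apply: (le_integrable measurableT _ _ iM).
  by apply/measurable_EFinP; apply: measurable_funM => //; exact: measurable_pvii_f.
by move=> x _ /=; rewrite lee_fin !normrM ler_wpM2r// (le_trans (gM x))// ler_norm.
Qed.

Lemma bounded_measurable_sample i (g : R -> R) (M : R) : measurable_fun setT g ->
  (forall x, `|g x| <= M) -> bounded_measurable (fun w => g (Z i w)).
Proof.
move=> mg gM; split; last by exists M.
exact: measurableT_comp mg (measurable_sample i).
Qed.

(** Adding the bound [M] reduces to the nonnegative case; since the density has mass 1, this adds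
    [M] to both sides. *)
Lemma sample_law i (g : R -> R) (M : R) : measurable_fun setT g -> (forall x, `|g x| <= M) ->
  \int[P]_w g (Z i w) = \int[mu]_x (g x * pvii_f m x).
Proof.
move=> mg gM; apply: (addIr M).
have bg := bounded_measurable_sample i mg gM.
have -> : \int[P]_w g (Z i w) + M = \int[P]_w (g (Z i w) + M).
  rewrite RintegralD//; last 2 first.
  - exact: bounded_measurable_integrable.
  - exact: (bounded_measurable_integrable P (bounded_measurable_cst T M)).
  by rewrite Rintegral_probability_cst.
rewrite /Rintegral (@sample_law_ge0 i (fun x => g x + M)).
- rewrite -/(Rintegral mu setT (fun x => (g x + M) * pvii_f m x)).
  under eq_Rintegral do rewrite mulrDl.
  rewrite RintegralD//; last 2 first.
  - exact: integrable_bounded_pvii gM.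
  - exact: (integrableZl measurableT _ integrable_pvii_f).
  by rewrite RintegralZl// ?Rintegral_pvii_f ?mulr1//; exact: integrable_pvii_f.
- exact: measurable_funD.
- by move=> x; have := gM x; rewrite ler_norml => /andP[]; lra.
Qed.

Lemma sample_independent : mutually_independent P Z.
Proof.
move=> s A us mA; have mA' i : measurable ((fun x : R => x - theta) @^-1` (A i)).
  by rewrite -[Y in measurable Y]setTI; apply: measurable_funB.
exact: (hind us mA').
Qed.

(** Applied to a likelihood ratio, this raises the affinity of one observation to the power [n], the
    source of the exponential bounds. *)
Lemma sample_prod n (g : R -> R) (h : R) : measurable_fun setT g -> (forall x, 0 <= g x) ->
  (\int[mu]_x (g x * pvii_f m x)%:E = h%:E)%E ->
  (\int[P]_w (\prod_(i < n) g (Z i w))%:E = (h ^+ n)%:E)%E.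
Proof.
move=> mg g0 gh.
have := @independent_integral_prod _ _ _ P Z measurable_sample sample_independent
  (fun=> g) (index_iota 0 n) (fun=> mg) (fun=> g0) (iota_uniq _ _).
under eq_integral do rewrite big_mkord; move=> ->; rewrite big_mkord.
under eq_bigr do rewrite sample_law_ge0// gh.
by rewrite prodEFin prodr_const card_ord.
Qed.

(** The product formula is stated for nonnegative functions, so it is applied to [g + M]; expanding
    the product, whose mean is [M * M], isolates the covariance. *)
Lemma sample_uncorrelated (i j : nat) (g : R -> R) (M : R) : i != j -> measurable_fun setT g ->
  (forall x, `|g x| <= M) -> \int[mu]_x (g x * pvii_f m x) = 0 ->
  \int[P]_w (g (Z i w) * g (Z j w)) = 0.
Proof.
move=> ij mg gM gE.
have b k := bounded_measurable_sample k mg gM.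
have bM := bounded_measurable_cst T M.
have E0 k : \int[P]_w g (Z k w) = 0 by rewrite (sample_law k mg gM).
have I := @bounded_measurable_integrable _ _ _ P.
have E1 k : \int[P]_w (g (Z k w) + M) = M.
  by rewrite RintegralD//; [rewrite Rintegral_probability_cst E0 add0r|exact: I|exact: (I _ bM)].
have gM0 x : 0 <= g x + M by have := gM x; rewrite ler_norml => /andP[]; lra.
have := @independent_integral_prod _ _ _ P Z measurable_sample sample_independent
  (fun=> fun x => g x + M) [:: i; j].
rewrite /= inE ij => /(_ _ _ isT) H.
have {}H := H (fun=> measurable_funD mg (@measurable_cst _ _ _ _ setT M)) (fun=> gM0).
move: H; rewrite !big_cons big_nil mule1.
under eq_integral do rewrite !big_cons big_nil mulr1.
rewrite !Rintegral_EFin; last 3 first.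
- by apply: bounded_measurableM; apply: bounded_measurableD.
- exact: bounded_measurableD.
- exact: bounded_measurableD.
rewrite !E1 -EFinM => -[].
have -> : \int[P]_w ((g (Z i w) + M) * (g (Z j w) + M)) =
   \int[P]_w (g (Z i w) * g (Z j w)) + M * M.
  under eq_Rintegral.
    move=> w _; rewrite (_ : _ * _ = g (Z i w) * g (Z j w) +
      (M * g (Z i w) + M * (g (Z j w) + M))); last by ring.
    over.
  rewrite !RintegralD ?RintegralZl ?E0 ?E1 ?mulr0 ?add0r//; try exact: I.
  - by apply: I; apply: bounded_measurableD.
  - by apply: I; apply: bounded_measurableM.
  - by apply: I; apply: bounded_measurableM => //; apply: bounded_measurableD.
  - by apply: I; apply: bounded_measurableM.
  - apply: I; apply: bounded_measurableD; first exact: bounded_measurableM.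
    by apply: bounded_measurableM => //; apply: bounded_measurableD.
by lra.
Qed.

(** Induction on [n]: a new observation adds its own second moment, and its cross products with the
    earlier ones have mean 0. *)
Lemma sample_sum_sqr n (g : R -> R) (M : R) : measurable_fun setT g ->
  (forall x, `|g x| <= M) -> \int[mu]_x (g x * pvii_f m x) = 0 ->
  \int[P]_w (\sum_(i < n) g (Z i w)) ^+ 2 = n%:R * \int[mu]_x (g x ^+ 2 * pvii_f m x).
Proof.
move=> mg gM gE; have b k := bounded_measurable_sample k mg gM.
have I := @bounded_measurable_integrable _ _ _ P.
have bS k : bounded_measurable (fun w => \sum_(i < k) g (Z i w)).
  exact: bounded_measurable_sum.
elim: n => [|n IH].
  under eq_Rintegral do rewrite big_ord0 expr0n/=.
  by rewrite Rintegral_probability_cst mul0r.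
under eq_Rintegral.
  move=> w _; rewrite big_ord_recr/= (_ : _ ^+ 2 = (\sum_(i < n) g (Z i w)) ^+ 2 +
    (g (Z n w) ^+ 2 + 2 * \sum_(i < n) g (Z i w) * g (Z n w))).
    over.
  by rewrite -mulr_suml; ring.
have bSg : bounded_measurable (fun w => \sum_(i < n) g (Z i w) * g (Z n w)).
  by apply: bounded_measurable_sum => i; exact: bounded_measurableM.
have b2S : bounded_measurable (fun w => 2 * \sum_(i < n) g (Z i w) * g (Z n w)).
  by apply: bounded_measurableM => //; exact: bounded_measurable_cst.
have bg2 : bounded_measurable (fun w => g (Z n w) ^+ 2) by exact: bounded_measurableM.
rewrite RintegralD//; last 2 first.
- by apply: I; exact: bounded_measurableM.
- by apply: I; exact: bounded_measurableD.
rewrite RintegralD//; [|exact: I|exact: I].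
rewrite RintegralZl//; last exact: I.
rewrite Rintegral_sum; last by move=> i; exact: bounded_measurableM.
rewrite big1 ?mulr0 ?addr0; last first.
  by move=> i _; rewrite (@sample_uncorrelated _ _ g M)// neq_ltn ltn_ord.
rewrite IH (@sample_law n (fun x => g x ^+ 2) (M ^+ 2)).
- by rewrite -[in RHS]natr1 mulrDl mul1r.
- exact: measurable_funX.
- by move=> x; rewrite normrX lerXn2r// nnegrE// (le_trans (normr_ge0 _) (gM x)).
Qed.

End sample.

(** * Moments of the score *)

Section moments.
Context (R : realType) (m : R) (hm : 1 / 2 < m).
Local Notation mu := (@lebesgue_measure R).

Lemma measurable_sqrp1V : measurable_fun setT (fun x : R => (1 + x ^+ 2)^-1).
Proof.
have := @measurable_powq0 R (- 1); congr (measurable_fun _ _); apply/funext => x.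
by rewrite powR_inv1// ltW// sqrp1_gt0.
Qed.

Lemma measurable_score : measurable_fun setT (@score R).
Proof. by apply: measurable_funM => //; exact: measurable_sqrp1V. Qed.

Lemma measurable_dscore : measurable_fun setT (@dscore R).
Proof.
rewrite (_ : dscore = fun x => (1 - x ^+ 2) * ((1 + x ^+ 2)^-1) ^+ 2); last first.
  by apply/funext => x; rewrite /dscore exprVn.
apply: measurable_funM; first by apply: measurable_funB => //; exact: measurable_funX.
by apply: measurable_funX; exact: measurable_sqrp1V.
Qed.

(** [score] is odd and the density even. Reflection is stated for nonnegative integrands, hence the
    shift to [score x + 1], which yields 1 - a = a + 1 for the mean a. *)
Lemma score_mean : \int[mu]_x (score x * pvii_f m x) = 0.
Proof.
have ms := measurable_score; have mf := measurable_pvii_f m.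
have f0 x := ltW (pvii_f_gt0 hm x).
have s2 (x : R) : -(1 / 2) <= score x <= 1 / 2 by rewrite -ler_norml norm_score_le.
have sN (x : R) : score (- x) = - score x by rewrite /score sqrrN mulNr.
have fN x : pvii_f m (- x) = pvii_f m x by rewrite /pvii_f sqrrN.
have := @lebesgue_integral_opp R (fun x => ((score x + 1) * pvii_f m x)%:E).
have m1 : measurable_fun setT (fun x => (score x + 1) * pvii_f m x).
  by apply: measurable_funM => //; exact: measurable_funD.
move/(_ _ _)/(congr1 fine).
have i1 := integrable_bounded_pvii hm ms (@norm_score_le R).
have i2 := integrable_pvii_f hm.
have -> : fine (\int[mu]_x ((score (- x) + 1) * pvii_f m (- x))%:E)%E =
    1 - \int[mu]_x (score x * pvii_f m x).
  rewrite -[X in _ = X - _](Rintegral_pvii_f hm) -RintegralB//.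
  by apply: eq_Rintegral => x _; rewrite sN fN; ring.
have -> : fine (\int[mu]_x ((score x + 1) * pvii_f m x)%:E)%E =
    \int[mu]_x (score x * pvii_f m x) + 1.
  rewrite -[X in _ = _ + X](Rintegral_pvii_f hm) -RintegralD//.
  by apply: eq_Rintegral => x _; ring.
move=> H; have : forall a : R, 1 - a = a + 1 -> a = 0 by move=> a ?; lra.
apply; apply: H; first exact/measurable_EFinP.
by move=> x; rewrite lee_fin mulr_ge0//; have := s2 x; lra.
Qed.

(** At this exponent the denominators of [score x ^+ 2] and [dscore x] cancel, leaving combinations
    of two powers. *)
Lemma pvii_fE2 x : pvii_f m x = pvii_c m * ((1 + x ^+ 2) ^+ 2 * (1 + x ^+ 2) `^ (- (m + 1 + 1))).
Proof. by rewrite /pvii_f -(powqS m) -(powqS (m + 1)) [in RHS]expr2 !mulrA. Qed.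

Lemma powq_int_quot1 : pvii_c m * powq_int (m + 1) = (2 * m - 1) / (2 * m).
Proof.
have m2 := hm; have I0 := powq_int_gt0 hm; have r1 := powq_int_rec hm.
rewrite pvii_cE; move: (powq_int m) (powq_int (m + 1)) I0 r1 => u v u0 r1.
apply: (@mulfI _ (2 * m)); first by rewrite gt_eqF//; lra.
by rewrite mulrCA r1; field; rewrite !gt_eqF//; lra.
Qed.

Lemma powq_int_quot2 : pvii_c m * powq_int (m + 1 + 1) =
  (2 * m - 1) / (2 * m) * ((2 * m + 1) / (2 * (m + 1))).
Proof.
have m2 := hm; have m1 : 1 / 2 < m + 1 by lra.
have r2 := powq_int_rec m1.
rewrite -powq_int_quot1 -mulrA; congr (_ * _).
move: (powq_int (m + 1)) (powq_int (m + 1 + 1)) r2 => u v r2.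
apply: (@mulfI _ (2 * (m + 1))); first by rewrite gt_eqF//; lra.
by rewrite r2; field; rewrite gt_eqF//; lra.
Qed.

Let i1 : mu.-integrable setT (EFin \o (fun x : R => (1 + x ^+ 2) `^ (- (m + 1)))).
Proof. by have m2 := hm; apply: integrable_powq; lra. Qed.

Let i2 : mu.-integrable setT (EFin \o (fun x : R => (1 + x ^+ 2) `^ (- (m + 1 + 1)))).
Proof. by have m2 := hm; apply: integrable_powq; lra. Qed.

(** The numerator x^2 = (1 + x^2) - 1 gives a difference of two consecutive integrals. This value is
    V of the overview. *)
Lemma score_sqr_mean : \int[mu]_x (score x ^+ 2 * pvii_f m x) = (2 * m - 1) / (4 * m * (m + 1)).
Proof.
transitivity (pvii_c m * powq_int (m + 1) - pvii_c m * powq_int (m + 1 + 1)).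
  rewrite /powq_int -!RintegralZl// -RintegralB//.
  - apply: eq_Rintegral => x _; rewrite pvii_fE2 -(powqS (m + 1)) /score.
    by field; rewrite gt_eqF// sqrp1_gt0.
  - exact: (integrableZl measurableT _ i1).
  - exact: (integrableZl measurableT _ i2).
rewrite powq_int_quot1 powq_int_quot2; field.
by have m2 := hm; apply/andP; split; rewrite gt_eqF//; lra.
Qed.

(** The numerator is 1 - x^2 = 2 - (1 + x^2). This value is J of the overview; it equals 2 m V,
    which is the information identity. *)
Lemma dscore_mean : \int[mu]_x (dscore x * pvii_f m x) = (2 * m - 1) / (2 * (m + 1)).
Proof.
transitivity (2 * pvii_c m * powq_int (m + 1 + 1) - pvii_c m * powq_int (m + 1)).
  rewrite /powq_int -!RintegralZl// -RintegralB//.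
  - apply: eq_Rintegral => x _; rewrite pvii_fE2 -(powqS (m + 1)) /dscore.
    by field; rewrite gt_eqF// sqrp1_gt0.
  - exact: (integrableZl measurableT _ i2).
  - exact: (integrableZl measurableT _ i1).
rewrite -mulrA powq_int_quot1 powq_int_quot2; field.
by have m2 := hm; apply/andP; split; rewrite gt_eqF//; lra.
Qed.

Lemma centered_dscore_mean (J := (2 * m - 1) / (2 * (m + 1))) :
  \int[mu]_x ((J - dscore x) * pvii_f m x) = 0.
Proof.
have i3 := integrable_bounded_pvii hm measurable_dscore (@norm_dscore_le R).
under eq_Rintegral do rewrite mulrBl.
have i4 := integrable_pvii_f hm.
rewrite RintegralB//; last exact: (integrableZl measurableT _ i4).
by rewrite RintegralZl// Rintegral_pvii_f// dscore_mean mulr1 subrr.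
Qed.

End moments.

(** * Likelihood ratios on a grid and Hellinger affinity *)

Section grid.
Context {R : realType}.
Implicit Types (e x z t eta del m : R) (n : nat).

Lemma prod_powR n (F : nat -> R) (p : R) : (forall i, 0 <= F i) ->
  \prod_(i < n) (F i `^ p) = (\prod_(i < n) F i) `^ p.
Proof.
move=> F0; elim: n => [|n IH]; first by rewrite !big_ord0 powR1.
by rewrite !big_ord_recr/= IH powRM// prodr_ge0.
Qed.

(** With h = v - u, one has 2 u h <= eta (1 + u^2), and h^2 <= eta because eta <= 1. *)
Lemma sqrp1_lipschitz (u v eta : R) : eta <= 1 -> `|v - u| <= eta ->
  1 + v ^+ 2 <= (1 + 2 * eta) * (1 + u ^+ 2).
Proof.
move=> eta1 vu; have -> : v = u + (v - u) by ring.
move: (v - u) vu => h; rewrite ler_norml => /andP[h1 h2].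
have := sqr_ge0 (u - 1); have := sqr_ge0 (u + 1); have := sqr_ge0 u.
have : h ^+ 2 <= eta by nra.
nra.
Qed.

(* The square root of f(z - t) / f(z), inflated to absorb the distance from the maximizer
   to the grid point t. *)
Definition lik_ratio m eta t z : R :=
  ((1 + 2 * eta) * ((1 + z ^+ 2) / (1 + (z - t) ^+ 2))) `^ (m / 2).

Lemma lik_ratio_ge0 m eta t z : 0 <= lik_ratio m eta t z.
Proof. exact: powR_ge0. Qed.

(** Minimality of [e] is used against [s] = 0, the true location after centering; passing from [e]
    to [t] costs at most a factor [1 + 2 * eta] per observation. *)
Lemma prod_lik_ratio_ge1 m n (z : nat -> R) e eta t : 0 < m -> 0 <= eta <= 1 ->
  (forall s, \prod_(i < n) (1 + (z i - e) ^+ 2) <= \prod_(i < n) (1 + (z i - s) ^+ 2)) ->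
  `|e - t| <= eta -> 1 <= \prod_(i < n) lik_ratio m eta t (z i).
Proof.
move=> m0 /andP[eta0 eta1] emin et.
pose F i : R := (1 + 2 * eta) * ((1 + z i ^+ 2) / (1 + (z i - t) ^+ 2)).
have F0 i : 0 <= F i.
  by rewrite mulr_ge0 ?divr_ge0 ?(ltW (sqrp1_gt0 _))//; lra.
rewrite /lik_ratio (@prod_powR n F)//.
suff F1 : 1 <= \prod_(i < n) F i.
  rewrite -[leLHS](congr1 (@^~ (m / 2)) (@powR1 R)).
  by apply: ge0_ler_powR; rewrite ?nnegrE ?prodr_ge0//; lra.
have Q0 : 0 < \prod_(i < n) (1 + (z i - t) ^+ 2).
  by apply: prodr_gt0 => i _; exact: sqrp1_gt0.
rewrite /F big_split/= prodf_div mulrA ler_pdivlMr// mul1r.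
have := emin 0; under [X in _ <= X -> _]eq_bigr do rewrite subr0.
move=> /(ler_wpM2l _) H; apply: le_trans (H _ _).
  rewrite -big_split/=; apply: ler_prod => i _; rewrite (ltW (sqrp1_gt0 _))/=.
  apply: sqrp1_lipschitz => //.
  by rewrite (_ : z i - t - (z i - e) = e - t)//; ring.
by apply: prodr_ge0 => i _; lra.
Qed.

Lemma grid_cover m n (z : nat -> R) e eta del : 0 < m -> 0 < eta <= 1 -> 2 * eta <= del ->
  (forall s, \prod_(i < n) (1 + (z i - e) ^+ 2) <= \prod_(i < n) (1 + (z i - s) ^+ 2)) ->
  del < `|e| ->
  exists k, [/\ del / 2 <= k%:R * eta, `|e| <= k.+1%:R * eta &
    1 <= \prod_(i < n) lik_ratio m eta (k%:R * eta) (z i) \/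
    1 <= \prod_(i < n) lik_ratio m eta (- (k%:R * eta)) (z i)].
Proof.
move=> m0 /andP[eta0 eta1] edel emin dele.
have : 0 <= `|e| / eta by rewrite divr_ge0// ltW.
(* The grid point [k * eta], with the sign of [e], is the next one toward 0; [2 * eta <= del] keeps
   it at distance at least [del / 2] from 0. *)
move=> /truncn_itv; set k := Num.truncn _ => /andP[].
rewrite ler_pdivlMr// ltr_pdivrMr// => k1 k2; exists k; split.
- by move: k2; rewrite -natr1 mulrDl mul1r; lra.
- exact: ltW.
have eta01 : 0 <= eta <= 1 by rewrite ltW.
have k2' : `|e| < k%:R * eta + eta by move: k2; rewrite -natr1 mulrDl mul1r.
have [e0|e0] := leP 0 e.
  left; apply: (@prod_lik_ratio_ge1 _ _ _ e) => //.
  by rewrite ger0_norm// in k1 k2'; rewrite ler_norml; apply/andP; split; lra.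
right; apply: (@prod_lik_ratio_ge1 _ _ _ e) => //.
by rewrite ltr0_norm// in k1 k2'; rewrite ler_norml; apply/andP; split; lra.
Qed.

End grid.

(** * Gap and decay of the Hellinger affinity *)

Section hellinger.
Context (R : realType) (m : R) (hm : 1 / 2 < m).
Local Notation mu := (@lebesgue_measure R).
Implicit Types (s t x eta : R).

(** The square root of the translated density without its constant:
    [pvii_c m * (hroot 0 x * hroot t x)] integrates to the Hellinger affinity. *)
Definition hroot t x : R := (1 + (x - t) ^+ 2) `^ (- (m / 2)).

Lemma hroot_ge0 t x : 0 <= hroot t x. Proof. exact: powR_ge0. Qed.

Lemma measurable_hroot t : measurable_fun setT (hroot t).
Proof. exact: measurable_powq. Qed.

Lemma hroot_sqr t x : hroot t x ^+ 2 = (1 + (x - t) ^+ 2) `^ (- m).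
Proof.
rewrite /hroot -powR_mulrn ?powR_ge0// -powRrM; congr (_ `^ _); lra.
Qed.

Lemma measurable_lik_ratio eta t : measurable_fun setT (lik_ratio m eta t).
Proof.
apply: (@measurableT_comp _ _ _ _ _ _ (@powR R ^~ (m / 2))) => //.
apply: measurable_funM => //; apply: measurable_funM.
  by apply: measurable_funD => //; exact: measurable_funX.
have := @measurable_powq R (- 1) t; congr (measurable_fun _ _); apply/funext => x.
by rewrite powR_inv1// ltW// sqrp1_gt0.
Qed.

Lemma lik_ratio_pvii eta t x : 0 <= eta -> lik_ratio m eta t x * pvii_f m x =
  (1 + 2 * eta) `^ (m / 2) * pvii_c m * (hroot 0 x * hroot t x).
Proof.
move=> eta0; have q0 := sqrp1_gt0 x; have q1 := sqrp1_gt0 (x - t).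
rewrite /lik_ratio powRM ?divr_ge0 ?(ltW q0) ?(ltW q1)//; last lra.
rewrite [((1 + x ^+ 2) / _) `^ _]powRM ?invr_ge0 ?(ltW q0) ?(ltW q1)//.
rewrite -[(1 + (x - t) ^+ 2)^-1]powR_inv1 ?(ltW q1)// -powRrM mulN1r.
rewrite /pvii_f /hroot subr0.
have -> : (1 + x ^+ 2) `^ (- m) = (1 + x ^+ 2) `^ (- (m / 2)) * (1 + x ^+ 2) `^ (- (m / 2)).
  by rewrite -powRD; [congr (_ `^ _); lra|rewrite (gt_eqF q0) implybT].
have := powRN (1 + x ^+ 2) (m / 2); have := powR_gt0 (m / 2) q0.
by move=> a0 ->; field; rewrite gt_eqF.
Qed.

Lemma integral_powq_shift p t : 1 / 2 < p ->
  (\int[mu]_x ((1 + (x - t) ^+ 2) `^ (- p))%:E = (powq_int p)%:E)%E.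
Proof.
move=> p2; rewrite -(powq_int_EFin p2).
rewrite (@lebesgue_integral_shift R (fun x => ((1 + x ^+ 2) `^ (- p))%:E))//.
- by apply/measurable_EFinP; exact: measurable_powq0.
- by move=> x; rewrite lee_fin powR_ge0.
Qed.

Lemma integral_powq_mean p t (a : R) : 1 / 2 < p -> 0 <= a ->
  (\int[mu]_x (a * ((1 + x ^+ 2) `^ (- p) + (1 + (x - t) ^+ 2) `^ (- p)))%:E =
   (a * (powq_int p + powq_int p))%:E)%E.
Proof.
move=> p2 a0.
have m1 : measurable_fun setT (fun x : R => ((1 + x ^+ 2) `^ (- p))%:E).
  by apply/measurable_EFinP; exact: measurable_powq0.
have m2 : measurable_fun setT (fun x : R => ((1 + (x - t) ^+ 2) `^ (- p))%:E).
  by apply/measurable_EFinP; exact: measurable_powq.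
under eq_integral do rewrite EFinM EFinD.
rewrite ge0_integralZl//.
- rewrite ge0_integralD//.
  + by rewrite powq_int_EFin// integral_powq_shift.
  + by move=> x _; rewrite lee_fin powR_ge0.
  + by move=> x _; rewrite lee_fin powR_ge0.
- exact: emeasurable_funD.
- by move=> x _; rewrite -EFinD lee_fin addr_ge0// powR_ge0.
Qed.

Lemma measurable_hroot2 t : measurable_fun setT (fun x => hroot 0 x * hroot t x).
Proof. by apply: measurable_funM; exact: measurable_hroot. Qed.

Lemma normB_far s t x : `|x| <= s -> 4 * s <= `|t| -> 3 * s <= `|x - t|.
Proof.
have := ler_normB x (x - t); rewrite (_ : x - (x - t) = t); last by ring.
lra.
Qed.

(* Away from t = 0 the square roots of the two densities differ by a fixed
   amount on [-s, s], which bounds the Hellinger affinity away from 1. *)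
Lemma affinity_gap s : 0 < s -> exists2 kappa : R, 0 < kappa <= 1 / 2 &
  forall t, 4 * s <= `|t| ->
    (\int[mu]_x (pvii_c m * (hroot 0 x * hroot t x))%:E <= (1 - kappa)%:E)%E.
Proof.
move=> s0; have m2 := hm; have c0 := pvii_c_gt0 hm; have I0 := powq_int_gt0 hm.
(* On [-s, s] the untranslated root is at least [a0]; the translated one is at most [b0], since
   [x - t] has modulus at least [3 * s] there. *)
pose a0 : R := (1 + s ^+ 2) `^ (- (m / 2)); pose b0 : R := (1 + (3 * s) ^+ 2) `^ (- (m / 2)).
have ab : b0 < a0.
  rewrite /a0 /b0 !powRN ltf_pV2 ?posrE ?powR_gt0 ?sqrp1_gt0//.
  apply: gt0_ltr_powR; rewrite ?nnegrE ?(ltW (sqrp1_gt0 _))//; first lra.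
  by rewrite exprMn; have := exprn_gt0 2 s0; lra.
pose g := pvii_c m / 2 * (a0 - b0) ^+ 2.
have g0 : 0 < g by rewrite mulr_gt0 ?divr_gt0// exprn_gt0// subr_gt0.
(* The cap at 1/2 keeps [1 - kappa] positive, as a geometric rate will be built from it. *)
exists (Num.min (g * (2 * s)) (1 / 2)).
  by rewrite lt_min ge_min lexx orbT andbT; apply/andP; split; [nra|lra].
move=> t ts.
have le1 : (\int[mu]_x (pvii_c m * (hroot 0 x * hroot t x))%:E + (g * (2 * s))%:E <= 1)%E.
  have mk : measurable_fun setT (fun x => (pvii_c m * (hroot 0 x * hroot t x))%:E).
    by apply/measurable_EFinP; apply: measurable_funM => //; exact: measurable_hroot2.
  have mi : measurable_fun setT (fun x : R => (g * \1_(`[- s, s] : set R) x)%:E).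
    by apply/measurable_EFinP; apply: measurable_funM.
  have -> : (g * (2 * s))%:E = (\int[mu]_x (g * \1_(`[- s, s] : set R) x)%:E)%E.
    under eq_integral do rewrite EFinM.
    have mI : measurable_fun setT (fun x : R => (\1_(`[- s, s] : set R) x)%:E : \bar R).
      exact/measurable_EFinP.
    have ind0 (x : R) : (0 <= (\1_(`[- s, s] : set R) x)%:E :> \bar R)%E by rewrite lee_fin.
    rewrite (ge0_integralZl mu measurableT mI (fun x _ => ind0 x)); last by rewrite lee_fin ltW.
    rewrite integral_indic// setIT [X in (_ * X)%E](_ : _ = (2 * s)%:E) ?EFinM//.
    rewrite [LHS]lebesgue_measure_itv/= lte_fin gtrN// -EFinB; congr EFin; ring.
  rewrite -ge0_integralD//; last 2 first.
  - by move=> x _; rewrite lee_fin !mulr_ge0 ?hroot_ge0// ltW.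
  - by move=> x _; rewrite lee_fin mulr_ge0// ltW.
  have -> : (1 = (pvii_c m / 2 * (powq_int m + powq_int m))%:E)%E.
    by rewrite pvii_cE; congr EFin; field; rewrite gt_eqF.
  rewrite -(@integral_powq_mean m t)//; last by rewrite divr_ge0// ltW.
  apply: ge0_le_integral => //.
  - move=> x _; rewrite adde_ge0// lee_fin; first by rewrite !mulr_ge0 ?hroot_ge0// ltW.
    by rewrite mulr_ge0// ltW.
  - exact: emeasurable_funD.
  - apply/measurable_EFinP; apply: measurable_funM => //.
    by apply: measurable_funD; [exact: measurable_powq0|exact: measurable_powq].
  move=> x _; rewrite -EFinD lee_fin -(hroot_sqr t) -[x in 1 + x ^+ 2](subr0 x) -(hroot_sqr 0).
  rewrite /g; set a := hroot 0 x; set b := hroot t x.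
  (* The last term is the defect in the arithmetic-geometric mean inequality; on [-s, s] it is at
     least [g]. *)
  have -> : pvii_c m / 2 * (a ^+ 2 + b ^+ 2) = pvii_c m * (a * b) + pvii_c m / 2 * (a - b) ^+ 2.
    by field.
  rewrite lerD2l indicE.
  have [xs|xs] := boolP (x \in _); last by rewrite mulr0 mulr_ge0 ?sqr_ge0// divr_ge0// ltW.
  rewrite mulr1 ler_wpM2l ?divr_ge0 ?(ltW c0)//.
  move: xs; rewrite inE/= in_itv/= -ler_norml => xs.
  have aa0 : a0 <= a.
    rewrite /a /hroot /a0 subr0 !powRN lef_pV2 ?posrE ?powR_gt0 ?sqrp1_gt0//.
    apply: ge0_ler_powR; rewrite ?nnegrE ?(ltW (sqrp1_gt0 _))//; first lra.
    by rewrite lerD2l -[x ^+ 2]real_normK ?num_real// lerXn2r ?nnegrE// ltW.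
  have bb0 : b <= b0.
    rewrite /b /hroot /b0 !powRN lef_pV2 ?posrE ?powR_gt0 ?sqrp1_gt0//.
    apply: ge0_ler_powR; rewrite ?nnegrE ?(ltW (sqrp1_gt0 _))//; first lra.
    rewrite lerD2l -[(x - t) ^+ 2]real_normK ?num_real//.
    rewrite lerXn2r ?nnegrE//; first by rewrite mulr_ge0// ltW.
    by exact: normB_far.
  by rewrite lerXn2r ?nnegrE ?subr_ge0//; lra.
have fin : (\int[mu]_x (pvii_c m * (hroot 0 x * hroot t x))%:E)%E \is a fin_num.
  rewrite ge0_fin_numE.
    rewrite (le_lt_trans _ (ltry 1))// (le_trans _ le1)// leeDl// lee_fin.
    by rewrite mulr_ge0 ?ltW// mulr_gt0.
  by apply: integral_ge0 => x _; rewrite lee_fin !mulr_ge0 ?hroot_ge0// ltW.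
move: le1; rewrite -(fineK fin) -EFinD !lee_fin => le1.
have : Num.min (g * (2 * s)) (1 / 2) <= g * (2 * s) by rewrite ge_min lexx.
lra.
Qed.

(** The product is at least 1 + x^2 + (x - t)^2, and x^2 + (x - t)^2 >= t^2 / 2 because (2 x - t)^2
    >= 0. *)
Lemma peetre x t : (1 + t ^+ 2) / 2 <= (1 + x ^+ 2) * (1 + (x - t) ^+ 2).
Proof.
have : 0 <= x ^+ 2 * (x - t) ^+ 2 by rewrite mulr_ge0 ?sqr_ge0.
have := sqr_ge0 (2 * x - t); nra.
Qed.

(** The exponent m / 2 is split as a + m' / 2 with m' halfway between 1/2 and m. By [peetre] the
    first part gives decay in [t]; the second stays integrable uniformly in [t] because m' > 1/2. *)
Lemma affinity_decay : exists a C : R, [/\ 0 < a, 0 < C & forall t,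
  (\int[mu]_x (pvii_c m * (hroot 0 x * hroot t x))%:E <= (C * (1 + t ^+ 2) `^ (- a))%:E)%E].
Proof.
have m2 := hm; pose m' := (m + 1 / 2) / 2; pose a := (m - m') / 2.
have m'2 : 1 / 2 < m' by rewrite /m'; lra.
have a0 : 0 < a by rewrite /a /m'; lra.
have c0 := pvii_c_gt0 hm; have I0 := powq_int_gt0 m'2.
exists a, (pvii_c m * (2^-1 `^ (- a) * powq_int m')); split => //.
  by rewrite !mulr_gt0// powR_gt0 ?invr_gt0.
move=> t; have qt := sqrp1_gt0 t.
pose b := pvii_c m * ((1 + t ^+ 2) / 2) `^ (- a) / 2.
have b0 : 0 <= b by rewrite divr_ge0// mulr_ge0 ?powR_ge0// ltW.
rewrite (_ : _ * _ `^ _ = b * (powq_int m' + powq_int m')); last first.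
  by rewrite /b powRM ?invr_ge0 ?ltW//; field.
rewrite -(@integral_powq_mean m' t)//; apply: ge0_le_integral => //.
- by move=> x _; rewrite lee_fin !mulr_ge0 ?hroot_ge0// ltW.
- by apply/measurable_EFinP; apply: measurable_funM => //; exact: measurable_hroot2.
- apply/measurable_EFinP; apply: measurable_funM => //.
  by apply: measurable_funD; [exact: measurable_powq0|exact: measurable_powq].
move=> x _; rewrite lee_fin /b -!mulrA ler_wpM2l ?(ltW c0)//.
have p0 := sqrp1_gt0 x; have q0 := sqrp1_gt0 (x - t).
rewrite /hroot subr0 -powRM ?(ltW p0) ?(ltW q0)//.
set p := 1 + x ^+ 2; set q := 1 + (x - t) ^+ 2.
have pq0 : 0 < p * q by rewrite mulr_gt0.
rewrite (_ : - (m / 2) = - a + - (m' / 2)); last by rewrite /a; lra.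
rewrite powRD; last by rewrite (gt_eqF pq0) implybT.
apply: ler_pM; rewrite ?powR_ge0//.
  rewrite !powRN lef_pV2 ?posrE ?powR_gt0 ?divr_gt0//.
  apply: ge0_ler_powR; rewrite ?nnegrE ?(ltW pq0) ?(ltW a0) ?divr_ge0 ?(ltW qt)//.
  exact: peetre.
rewrite powRM ?(ltW p0) ?(ltW q0)//.
have sq y : 0 < y -> y `^ (- m') = (y `^ (- (m' / 2))) ^+ 2.
  by move=> y0; rewrite -powR_mulrn ?powR_ge0// -powRrM; congr (_ `^ _); lra.
rewrite !sq//; set u := p `^ _; set v := q `^ _.
by have := sqr_ge0 (u - v); lra.
Qed.

End hellinger.

(** * Tail and mean square error of the estimator *)

Section sequences.
Context {R : realType}.

(** The partial sums of 1 / ((k + 1) (k + 2)) telescope to 1 - 1 / (n + 1). *)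
Lemma nneseries_telescope_le (B : R) (x : nat -> \bar R) : 0 <= B ->
  (forall k, 0 <= x k)%E -> (forall k, x k <= (B / (k.+1%:R * k.+2%:R))%:E)%E ->
  (\sum_(0 <= k <oo) x k <= B%:E)%E.
Proof.
move=> B0 x0 xB; apply: lime_le; first exact: is_cvg_nneseries.
apply: nearW => n; apply: (@le_trans _ _ (B * (1 - n.+1%:R^-1))%:E).
  elim: n => [|n IH]; first by rewrite big_nil invr1 subrr mulr0.
  rewrite big_nat_recr//= (le_trans (leeD IH (xB n)))// -EFinD lee_fin.
  rewrite le_eqVlt; apply/orP; left; apply/eqP.
  have n1 : n.+1%:R != 0 :> R by rewrite pnatr_eq0.
  have n2 : n.+2%:R != 0 :> R by rewrite pnatr_eq0.
  have E : n.+2%:R = n.+1%:R + 1 :> R by rewrite natr1.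
  move: (n.+1%:R) (n.+2%:R) n1 n2 E => u v u0 v0 E; rewrite E in v0 *.
  by field; rewrite ?u0 ?v0.
by rewrite lee_fin ler_piMr// lerBlDr lerDl invr_ge0.
Qed.

(** With r = s^2, Bernoulli's inequality bounds n s^n, and the other factor s^n tends to 0. *)
Lemma cvg_natrM_expr (r : R) : 0 < r < 1 -> n%:R * r ^+ n @[n --> \oo] --> (0 : R).
Proof.
move=> /andP[r0 r1]; pose s := Num.sqrt r.
have s0 : 0 < s by rewrite sqrtr_gt0.
have s1 : s < 1 by rewrite -sqrtr1 ltr_sqrt.
have sr : r = s * s by rewrite -expr2 sqr_sqrtr// ltW.
have ns n : n%:R * s ^+ n <= (s^-1 - 1)^-1.
  have d0 : 0 < s^-1 - 1 by rewrite subr_gt0 invf_gt1.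
  rewrite -(@ler_pM2r _ (s^-1 - 1)) // mulVf ?gt_eqF// mulrAC.
  rewrite -ler_pdivlMr ?exprn_gt0// mul1r -exprVn.
  have : 1 + n%:R * (s^-1 - 1) <= s^-1 ^+ n.
    elim: n => [|n IH]; first by rewrite mul0r addr0.
    have S1 : 1 <= s^-1 ^+ n by rewrite exprn_ege1// ltW// invf_gt1.
    by rewrite exprS -natr1; nra.
  lra.
have B0 : 0 <= (s^-1 - 1)^-1 by rewrite invr_ge0 subr_ge0 ltW// invf_gt1.
apply: (@squeeze_cvgr _ _ _ _ (fun=> 0) (geometric (s^-1 - 1)^-1 s)).
- apply: nearW => n /=; rewrite mulr_ge0 ?exprn_ge0 ?(ltW r0)//=.
  by rewrite sr exprMn mulrA ler_wpM2r ?exprn_ge0 ?(ltW s0).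
- exact: cvg_cst.
- by apply: cvg_geometric; rewrite ger0_norm// ltW.
Qed.

End sequences.

Section estimator.
Context (R : realType) (m : R) (hm : 1 / 2 < m) (theta : R)
  (d : measure_display) (T : measurableType d) (P : probability T R)
  (X : nat -> T -> R) (hlaw : forall i : nat, has_law_PVII P m theta (X i))
  (hind : mutually_independent P X)
  (e : nat -> T -> R) (me : forall n, measurable_fun setT (e n))
  (emin : forall n w s, \prod_(i < n) (1 + (X i w - theta - e n w) ^+ 2) <=
     \prod_(i < n) (1 + (X i w - theta - s) ^+ 2)).
Local Notation mu := (@lebesgue_measure R).
Local Notation Z := (fun i w => X i w - theta).

Definition tail4 (del : R) n w : R := if del < `|e n w| then e n w ^+ 4 else 0.

Lemma tail4_ge0 del n w : 0 <= tail4 del n w.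
Proof. by rewrite /tail4; case: ifP => // _; rewrite exprn_even_ge0. Qed.

Lemma measurable_tail4 del n : measurable_fun setT (tail4 del n).
Proof.
apply: measurable_fun_ifT => //; last exact: measurable_funX.
by apply: measurable_fun_ltr => //; apply: measurableT_comp.
Qed.

Lemma lik_ratio_integral (eta t : R) : 0 <= eta ->
  (\int[mu]_x (lik_ratio m eta t x * pvii_f m x)%:E =
   ((1 + 2 * eta) `^ (m / 2))%:E * \int[mu]_x (pvii_c m * (hroot m 0 x * hroot m t x))%:E)%E.
Proof.
move=> eta0.
have mk : measurable_fun setT (fun x => (pvii_c m * (hroot m 0 x * hroot m t x))%:E).
  by apply/measurable_EFinP; apply: measurable_funM => //; exact: measurable_hroot2.
have k0 x : (0 <= (pvii_c m * (hroot m 0 x * hroot m t x))%:E)%E.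
  by rewrite lee_fin !mulr_ge0 ?hroot_ge0// ltW// pvii_c_gt0.
rewrite -(ge0_integralZl mu measurableT mk (fun x _ => k0 x)) ?lee_fin ?powR_ge0//.
by apply: eq_integral => x _; rewrite lik_ratio_pvii// -EFinM -[in LHS]mulrA.
Qed.

(** [eta] is chosen after the gap [kappa], so small that the inflation factor is at most 1 + kappa;
    the mean is then at most (1 + kappa) (1 - kappa) < 1. *)
Lemma lik_ratio_mean_bound (del : R) : 0 < del -> exists eta r a C : R,
  [/\ 0 < eta <= 1, 2 * eta <= del, 0 < r < 1, 0 < a /\ 0 < C & forall t, del / 2 <= `|t| ->
    exists2 u : R, (\int[mu]_x (lik_ratio m eta t x * pvii_f m x)%:E = u%:E)%E &
      [/\ 0 <= u, u <= r & u <= C * (1 + t ^+ 2) `^ (- a)]].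
Proof.
move=> del0; have m2 := hm.
(* The gap holds from modulus 4 * (del / 8) = del / 2 on, which covers the grid points in use. *)
have s0 : 0 < del / 8 by lra.
have [kappa /andP[k0 k1] gap] := affinity_gap hm s0.
have [a [C [a0 C0 decay]]] := affinity_decay hm.
pose b : R := (1 + kappa) `^ (2 / m).
have b1 : 1 < b.
  have := @gt0_ltr_powR _ (2 / m) _ 1 (1 + kappa); rewrite powR1; apply; rewrite ?nnegrE; try lra.
  by rewrite divr_gt0//; lra.
pose eta := Num.min (Num.min 1 (del / 2)) ((b - 1) / 2).
have eta0 : 0 < eta by rewrite !lt_min; apply/andP; split; [apply/andP; split|]; lra.
have eta1 : eta <= 1 by rewrite !ge_min lexx.
have eta2 : 2 * eta <= del.
  have : eta <= del / 2 by rewrite !ge_min lexx orbT.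
  lra.
have eta3 : 1 + 2 * eta <= b.
  have : eta <= (b - 1) / 2 by rewrite !ge_min lexx orbT.
  lra.
pose G := (1 + 2 * eta) `^ (m / 2).
have G0 : 0 < G by apply: powR_gt0; lra.
have G1 : G <= 1 + kappa.
  have -> : 1 + kappa = b `^ (m / 2).
    rewrite /b -powRrM (_ : 2 / m * (m / 2) = 1) ?powRr1//; first lra.
    by field; rewrite gt_eqF//; lra.
  by apply: ge0_ler_powR; rewrite ?nnegrE ?powR_ge0//; lra.
exists eta, ((1 + kappa) * (1 - kappa)), a, (G * C); split => //.
- by rewrite eta0.
- by apply/andP; split; nra.
- by rewrite mulr_gt0.
move=> t tdel.
have {gap}gap := gap t; have {decay}decay := decay t.
have fin : (\int[mu]_x (pvii_c m * (hroot m 0 x * hroot m t x))%:E)%E \is a fin_num.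
  rewrite ge0_fin_numE; first by rewrite (le_lt_trans decay)// ltry.
  by apply: integral_ge0 => x _; rewrite lee_fin !mulr_ge0 ?hroot_ge0// ltW// pvii_c_gt0.
rewrite lik_ratio_integral ?ltW//.
have I0 : (0 <= \int[mu]_x (pvii_c m * (hroot m 0 x * hroot m t x))%:E)%E.
  by apply: integral_ge0 => x _; rewrite lee_fin !mulr_ge0 ?hroot_ge0// ltW// pvii_c_gt0.
move: gap decay I0; rewrite -(fineK fin); set h := fine _; rewrite !lee_fin => gap decay h0.
exists (G * h); first by rewrite EFinM.
split.
- by rewrite mulr_ge0// ltW.
- by apply: ler_pM => //; [exact: ltW|apply: gap; lra].
- by rewrite -mulrA ler_pM2l.
Qed.

(** The weight dominates the fourth power of any error of modulus at most [k.+1 * eta]; adding the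
    products at both signs avoids a case distinction on the sign of the error. *)
Definition grid_term (del eta : R) n k w : R :=
  if del / 2 <= k%:R * eta then (k.+1%:R * eta) ^+ 4 *
    (\prod_(i < n) lik_ratio m eta (k%:R * eta) (Z i w) +
     \prod_(i < n) lik_ratio m eta (- (k%:R * eta)) (Z i w)) else 0.

Lemma prod_lik_ratio_ge0 eta t n w : 0 <= \prod_(i < n) lik_ratio m eta t (Z i w).
Proof. by apply: prodr_ge0 => i _; exact: lik_ratio_ge0. Qed.

Lemma grid_term_ge0 del eta n k w : 0 <= grid_term del eta n k w.
Proof.
rewrite /grid_term; case: ifP => // _.
by rewrite mulr_ge0 ?exprn_even_ge0// addr_ge0// prod_lik_ratio_ge0.
Qed.

Lemma measurable_prod_lik_ratio eta t n :
  measurable_fun setT (fun w => \prod_(i < n) lik_ratio m eta t (Z i w)).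
Proof.
apply: measurable_prod => i _; apply: measurableT_comp (measurable_sample hlaw i).
exact: measurable_lik_ratio.
Qed.

Lemma measurable_grid_term del eta n k : measurable_fun setT (grid_term del eta n k).
Proof.
rewrite /grid_term; case: (del / 2 <= k%:R * eta) => //.
apply: measurable_funM => //; apply: measurable_funD; exact: measurable_prod_lik_ratio.
Qed.

(** A pointwise union bound: beyond [del], [grid_cover] provides a term whose likelihood product is
    at least 1, and all terms are nonnegative. *)
Lemma tail4_le_series (del eta : R) n w : 0 < eta <= 1 -> 2 * eta <= del ->
  ((tail4 del n w)%:E <= \sum_(0 <= k <oo) (grid_term del eta n k w)%:E)%E.
Proof.
move=> eta01 edel; have m2 := hm; have eta0 : 0 < eta by case/andP: eta01.
have G0 k : (0 <= (grid_term del eta n k w)%:E)%E by rewrite lee_fin grid_term_ge0.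
rewrite /tail4; case: ifPn => [dele|_]; last exact: nneseries_ge0.
have m0 : 0 < m by lra.
have [k [k1 k2 k3]] := @grid_cover R m n (fun i => X i w - theta) _ _ _
  m0 eta01 edel (emin n w) dele.
apply: (@le_trans _ _ (grid_term del eta n k w)%:E).
  rewrite lee_fin /grid_term k1.
  apply: (@le_trans _ _ ((k.+1%:R * eta) ^+ 4)).
    rewrite -[leLHS]ger0_norm ?exprn_even_ge0// normrX.
    by rewrite lerXn2r ?nnegrE// mulr_ge0// ltW.
  rewrite ler_peMr ?exprn_even_ge0//.
  have := prod_lik_ratio_ge0 eta (k%:R * eta) n w.
  have := prod_lik_ratio_ge0 eta (- (k%:R * eta)) n w.
  by case: k3; lra.
apply: le_trans (nneseries_lim_ge k.+1 _); last by [].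
by rewrite big_nat_recr//= leeDr// sume_ge0.
Qed.

(** With y = ((k + 1) eta)^2 and q = 1 + (k eta)^2, the bound y <= 2 q gives y^2 / q^3 <= 8 / y. The
    right-hand side is put in a form that telescopes. *)
Lemma grid_weight (k : nat) (eta : R) : 0 < eta <= 1 ->
  (k.+1%:R * eta) ^+ 4 * (1 + (k%:R * eta) ^+ 2) ^- 3 <= 16 / eta ^+ 2 / (k.+1%:R * k.+2%:R).
Proof.
move=> /andP[eta0 eta1].
have k0 : 0 <= k%:R :> R by [].
have e2 := exprn_gt0 2 eta0.
have q0 := sqrp1_gt0 (k%:R * eta).
pose y : R := k.+1%:R ^+ 2 * eta ^+ 2.
have k1 : 0 < k.+1%:R :> R by [].
have y0 : 0 < y by rewrite mulr_gt0// exprn_gt0.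
have yq : y <= 2 * (1 + (k%:R * eta) ^+ 2).
  rewrite /y -natr1; have := sqr_ge0 ((k%:R - 1) * eta); nra.
have -> : (k.+1%:R * eta) ^+ 4 = y ^+ 2 by rewrite /y; ring.
have y3 : y ^+ 3 <= 8 * (1 + (k%:R * eta) ^+ 2) ^+ 3.
  rewrite (_ : 8 * _ = (2 * (1 + (k%:R * eta) ^+ 2)) ^+ 3); last by ring.
  by rewrite lerXn2r ?nnegrE ?(ltW y0)// mulr_ge0// ltW.
apply: (@le_trans _ _ (8 / y)).
  rewrite ler_pdivrMr ?exprn_gt0// mulrAC ler_pdivlMr//; lra.
rewrite (_ : 8 / y = 8 / eta ^+ 2 / k.+1%:R ^+ 2); last by rewrite /y; field; rewrite !gt_eqF.
rewrite (_ : 16 / eta ^+ 2 / (k.+1%:R * k.+2%:R) =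
  8 / eta ^+ 2 * (2 / (k.+1%:R * k.+2%:R))); last first.
  by field; rewrite !gt_eqF.
rewrite ler_wpM2l ?divr_ge0 ?(ltW e2)//.
rewrite ler_pdivlMr ?mulr_gt0// mulrC ler_pdivrMr ?exprn_gt0//.
have k1' : 1 <= k.+1%:R :> R by rewrite ler1n.
by rewrite (_ : k.+2%:R = k.+1%:R + 1 :> R) ?natr1//; nra.
Qed.

(** Of the [n] factors, [n0] are spent on polynomial decay, which makes the sum over the grid
    converge despite the fourth powers; the other [n - n0] give the exponential rate. *)
Lemma tail4_mean (del : R) : 0 < del -> exists n0 (K r : R), [/\ 0 <= K, 0 < r < 1 &
  forall n, (n0 <= n)%N -> (\int[P]_w (tail4 del n w)%:E <= (K * r ^+ n)%:E)%E].
Proof.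
move=> del0.
have [eta [r [a [C [eta01 edel /andP[r0 r1] [a0 C0] bnd]]]]] := lik_ratio_mean_bound del0.
have eta0 : 0 < eta by case/andP: eta01.
(* Then (1 + t^2)^(- a n0) is at most (1 + t^2)^(-3), the power that [grid_weight] requires. *)
pose n0 := Num.bound (3 / a).
have an0 : 3 <= a * n0%:R.
  rewrite mulrC -ler_pdivrMr// ltW//; apply: archi_boundP.
  by rewrite divr_ge0// ltW.
have H t n : del / 2 <= `|t| -> (n0 <= n)%N -> exists2 v : R,
    (\int[P]_w (\prod_(i < n) lik_ratio m eta t (Z i w))%:E = v%:E)%E &
    v <= (C / r) ^+ n0 * r ^+ n * (1 + t ^+ 2) ^- 3.
  move=> tdel nn0; have [u uE [u0 ur uC]] := bnd t tdel.
  exists (u ^+ n).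
    apply: (sample_prod hm hlaw hind) => //; first exact: measurable_lik_ratio.
    by move=> x; exact: lik_ratio_ge0.
  rewrite -(subnK nn0) !exprD; have q0 := sqrp1_gt0 t.
  apply: (@le_trans _ _ (r ^+ (n - n0) * (C ^+ n0 * (1 + t ^+ 2) ^- 3))).
    apply: ler_pM; rewrite ?exprn_ge0//.
      by rewrite lerXn2r ?nnegrE// ltW.
    apply: (@le_trans _ _ ((C * (1 + t ^+ 2) `^ (- a)) ^+ n0)).
      by rewrite lerXn2r ?nnegrE// mulr_ge0 ?powR_ge0// ltW.
    rewrite exprMn ler_wpM2l ?exprn_ge0 ?(ltW C0)//.
    rewrite -[_ ^+ n0]powR_mulrn ?powR_ge0// -powRrM -[_ ^- 3]powR_invn ?(ltW q0)//.
    apply: ler_powR; first exact: sqrp1_ge1.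
    by rewrite mulNr; lra.
  rewrite exprMn exprVn le_eqVlt; apply/orP; left; apply/eqP.
  by field; rewrite !gt_eqF// exprn_gt0.
have CR : 0 <= (C / r) ^+ n0 by rewrite exprn_ge0// divr_ge0// ltW.
(* The factor 32 is the 16 of [grid_weight] for each of the two signs; dividing by [r ^+ n0]
   restores the full power [r ^+ n]. *)
exists n0, (32 / eta ^+ 2 * (C / r) ^+ n0), r; split.
- by rewrite mulr_ge0// divr_ge0// exprn_ge0// ltW.
- by rewrite r0.
move=> n nn0.
have mG k : measurable_fun setT (fun w => (grid_term del eta n k w)%:E).
  by apply/measurable_EFinP; exact: measurable_grid_term.
apply: (@le_trans _ _ (\int[P]_w \sum_(0 <= k <oo) (grid_term del eta n k w)%:E)%E).
  apply: ge0_le_integral => //.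
  - by move=> w _; rewrite lee_fin tail4_ge0.
  - by apply/measurable_EFinP; exact: measurable_tail4.
  - by apply: ge0_emeasurable_sum => // k w _ _; rewrite lee_fin grid_term_ge0.
  - by move=> w _; apply: tail4_le_series.
rewrite integral_nneseries//; last by move=> k w _; rewrite lee_fin grid_term_ge0.
have rn0 : 0 <= r ^+ n by rewrite exprn_ge0// ltW.
apply: nneseries_telescope_le.
- by rewrite mulr_ge0// mulr_ge0// divr_ge0// exprn_ge0// ltW.
- by move=> k; apply: integral_ge0 => w _; rewrite lee_fin grid_term_ge0.
move=> k.
have e20 : 0 <= 32 / eta ^+ 2 by rewrite divr_ge0// exprn_ge0// ltW.
rewrite /grid_term; case: (boolP (del / 2 <= k%:R * eta)) => [kdel|_]; last first.
  by rewrite integral0 lee_fin divr_ge0// mulr_ge0// mulr_ge0.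
have k0 : 0 <= k%:R * eta by rewrite mulr_ge0// ltW.
have t1 : del / 2 <= `|k%:R * eta| by rewrite ger0_norm.
have t2 : del / 2 <= `|- (k%:R * eta)| by rewrite normrN.
have [v1 E1 B1] := H _ n t1 nn0; have [v2 E2 B2] := H _ n t2 nn0.
have mp t : measurable_fun setT (fun w => (\prod_(i < n) lik_ratio m eta t (Z i w))%:E).
  by apply/measurable_EFinP; exact: measurable_prod_lik_ratio.
under eq_integral do rewrite EFinM EFinD.
rewrite ge0_integralZl//; last 3 first.
- exact: emeasurable_funD.
- by move=> w _; rewrite -EFinD lee_fin addr_ge0// prod_lik_ratio_ge0.
- by rewrite lee_fin exprn_even_ge0.
rewrite ge0_integralD//; last 2 first.
- by move=> w _; rewrite lee_fin prod_lik_ratio_ge0.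
- by move=> w _; rewrite lee_fin prod_lik_ratio_ge0.
rewrite E1 E2 -EFinD -EFinM lee_fin.
rewrite sqrrN in B2.
have W := grid_weight k eta01.
set D := (C / r) ^+ n0 * r ^+ n in B1 B2.
have D0 : 0 <= D by rewrite mulr_ge0.
set F := (k.+1%:R * eta) ^+ 4 in W *; have F0 : 0 <= F by rewrite exprn_even_ge0.
set Q := (1 + (k%:R * eta) ^+ 2) ^- 3 in W B1 B2.
apply: (@le_trans _ _ (F * (2 * (D * Q)))).
  by apply: ler_wpM2l => //; lra.
rewrite (_ : F * _ = 2 * D * (F * Q)); last by ring.
rewrite [leRHS](_ : _ = 2 * D * (16 / eta ^+ 2 / (k.+1%:R * k.+2%:R))); last first.
  by rewrite /D; field; rewrite !gt_eqF.
by rewrite ler_wpM2l// mulr_ge0.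
Qed.

Local Notation J := ((2 * m - 1) / (2 * (m + 1))).
Local Notation V := ((2 * m - 1) / (4 * m * (m + 1))).

Lemma normalizer_bounds : 0 < J <= 1.
Proof.
have m2 := hm; rewrite divr_gt0//=; [|lra|lra].
by rewrite ler_pdivrMr; lra.
Qed.

Lemma norm_centered_dscore_le (x : R) : `|J - dscore x| <= 2.
Proof.
have /andP[J0 J1] := normalizer_bounds.
by have := norm_dscore_le x; rewrite !ler_norml => /andP[? ?]; apply/andP; split; lra.
Qed.

Lemma measurable_centered_dscore : measurable_fun setT (fun x : R => J - dscore x).
Proof. by apply: measurable_funB => //; exact: measurable_dscore. Qed.

(** Together with [info_gap], these are A and D of the overview. *)
Definition score_avg n w : R := n%:R^-1 * \sum_(i < n) score (Z i w).
Definition info_gap n w : R := n%:R^-1 * \sum_(i < n) (J - dscore (Z i w)).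

Lemma bounded_sqr_mean n (g : R -> R) (M : R) : measurable_fun setT g ->
  (forall x, `|g x| <= M) ->
  bounded_measurable (fun w => (n%:R^-1 * \sum_(i < n) g (Z i w)) ^+ 2).
Proof.
move=> mg gM; have bS : bounded_measurable (fun w => n%:R^-1 * \sum_(i < n) g (Z i w)).
  apply: bounded_measurableM; first exact: bounded_measurable_cst.
  by apply: bounded_measurable_sum => i; exact: (bounded_measurable_sample hlaw _ mg gM).
exact: bounded_measurableM.
Qed.

Lemma mean_sqr n (g : R -> R) (M : R) : (0 < n)%N -> measurable_fun setT g ->
  (forall x, `|g x| <= M) -> \int[mu]_x (g x * pvii_f m x) = 0 ->
  \int[P]_w (n%:R^-1 * \sum_(i < n) g (Z i w)) ^+ 2 =
  n%:R^-1 * \int[mu]_x (g x ^+ 2 * pvii_f m x).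
Proof.
move=> n0 mg gM gE; under eq_Rintegral do rewrite exprMn.
have bS : bounded_measurable (fun w => \sum_(i < n) g (Z i w)).
  by apply: bounded_measurable_sum => i; exact: (bounded_measurable_sample hlaw _ mg gM).
rewrite RintegralZl//; last first.
  by apply: bounded_measurable_integrable; exact: bounded_measurableM.
rewrite (sample_sum_sqr hm hlaw hind n mg gM gE) mulrA; congr (_ * _).
by field; rewrite pnatr_eq0 -lt0n.
Qed.

Lemma error_pointwise n w (eta : R) : (0 < n)%N -> 0 < eta <= 1 ->
  `|J ^+ 2 * e n w ^+ 2 - score_avg n w ^+ 2| <=
    2 * eta * score_avg n w ^+ 2 + 5 * eta * info_gap n w ^+ 2 +
    20 / eta ^+ 3 * tail4 (J * eta ^+ 2 / 20) n w.
Proof.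
move=> n0 eta01; apply: sqr_error_bound => //; first exact: normalizer_bounds.
- have n0' : 0 < n%:R :> R by rewrite ltr0n.
  rewrite /info_gap normrM ger0_norm ?invr_ge0// mulrC ler_pdivrMr//.
  rewrite (le_trans (ler_norm_sum _ _ _))//.
  rewrite (_ : 2 * n%:R = \sum_(i < n) 2).
    by apply: ler_sum => i _; exact: norm_centered_dscore_le.
  by rewrite sumr_const card_ord -[RHS]mulr_natr.
- exact: (@score_expansion R n (fun i => X i w - theta)).
Qed.

Lemma tail4_integrable (del : R) n (c : R) :
  (\int[P]_w (tail4 del n w)%:E <= c%:E)%E ->
  P.-integrable setT (EFin \o tail4 del n).
Proof.
move=> tc; apply/integrableP; split.
  by apply/measurable_EFinP; exact: measurable_tail4.
under eq_integral do rewrite gee0_abs ?lee_fin ?tail4_ge0//.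
by rewrite (le_lt_trans tc)// ltry.
Qed.

(** The square is at most [del ^+ 2] below the threshold and at most [e ^+ 4 / del ^+ 2] above
    it. *)
Lemma sqr_error_integrable (del : R) n (c : R) : 0 < del ->
  (\int[P]_w (tail4 del n w)%:E <= c%:E)%E ->
  P.-integrable setT (EFin \o (fun w => e n w ^+ 2)).
Proof.
move=> del0 /tail4_integrable it.
have i1 : P.-integrable setT (fun w => (del ^+ 2)%:E).
  exact: (finite_measure_integrable_cst P (del ^+ 2)).
have i2 := integrableZl measurableT (del ^- 2) it.
apply: (le_integrable measurableT _ _ (integrableD measurableT i1 i2)).
  by apply/measurable_EFinP; exact: measurable_funX.
move=> w _ /=; rewrite lee_fin.
have d2 := exprn_gt0 2 del0.
rewrite !ger0_norm ?sqr_ge0//; last first.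
  by rewrite addr_ge0 ?(ltW d2)// mulr_ge0 ?tail4_ge0// invr_ge0 ltW.
rewrite /tail4; case: ltP => [lt|le].
  rewrite -[leLHS]add0r lerD ?(ltW d2)// mulrC ler_pdivlMr//.
  rewrite (_ : e n w ^+ 4 = e n w ^+ 2 * e n w ^+ 2); last by ring.
  rewrite ler_wpM2l ?sqr_ge0// -(@real_normK _ (e n w)) ?num_real//.
  by rewrite lerXn2r ?nnegrE// ltW.
rewrite mulr0 addr0 -(@real_normK _ (e n w)) ?num_real//.
by rewrite lerXn2r ?nnegrE// ltW.
Qed.

(** The mean of [score_avg ^+ 2] is exactly V / n, so scaling by [n] leaves an error proportional to
    [eta] and a tail in n r^n. As [n0], [K] and [r] depend on [eta], it has to be fixed before [n]
    grows. *)
Lemma scaled_error_bound (eta : R) : 0 < eta <= 1 -> exists n0 (K r : R),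
  [/\ 0 < r < 1 & forall n, (n0 <= n)%N -> (0 < n)%N ->
   P.-integrable setT (EFin \o (fun w => e n w ^+ 2)) /\
   `|J ^+ 2 * (n%:R * \int[P]_w e n w ^+ 2) - V| <=
     eta * (2 * V + 5 * \int[mu]_x ((J - dscore x) ^+ 2 * pvii_f m x)) +
     K * (n%:R * r ^+ n)].
Proof.
move=> eta01; have /andP[eta0 eta1] := eta01; have /andP[J0 J1] := normalizer_bounds.
pose del := J * eta ^+ 2 / 20.
have del0 : 0 < del by rewrite /del divr_gt0// mulr_gt0// exprn_gt0.
have [n0 [K [r [K0 r01 tail]]]] := tail4_mean del0.
exists n0, (20 / eta ^+ 3 * K), r; split => // n nn0 n1.
have {}tail := tail n nn0.
have ie := sqr_error_integrable del0 tail.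
have it := tail4_integrable tail.
split => //.
have n1' : 0 < n%:R :> R by rewrite ltr0n.
have iA : P.-integrable setT (EFin \o (fun w => score_avg n w ^+ 2)).
  apply: bounded_measurable_integrable.
  exact (bounded_sqr_mean n (@measurable_score R) (@norm_score_le R)).
have iD : P.-integrable setT (EFin \o (fun w => info_gap n w ^+ 2)).
  apply: bounded_measurable_integrable.
  exact (bounded_sqr_mean n measurable_centered_dscore norm_centered_dscore_le).
have iZ (f : T -> R) c : P.-integrable setT (EFin \o f) ->
    P.-integrable setT (EFin \o (fun w => c * f w)).
  by move=> jf; exact: (integrableZl measurableT c jf).
have iS (f g : T -> R) : P.-integrable setT (EFin \o f) -> P.-integrable setT (EFin \o g) ->
    P.-integrable setT (EFin \o (fun w => f w + g w)).
  by move=> jf jg; exact: (integrableD measurableT jf jg).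
have EA : \int[P]_w score_avg n w ^+ 2 = n%:R^-1 * V.
  rewrite (mean_sqr n1 (@measurable_score R) (@norm_score_le R)) ?score_sqr_mean//.
  exact: score_mean.
have ED : \int[P]_w info_gap n w ^+ 2 =
    n%:R^-1 * \int[mu]_x ((J - dscore x) ^+ 2 * pvii_f m x).
  rewrite (mean_sqr n1 measurable_centered_dscore norm_centered_dscore_le)//.
  exact: centered_dscore_mean.
set W := \int[mu]_x _ in ED *.
have ET : \int[P]_w tail4 del n w <= K * r ^+ n.
  rewrite -lee_fin fineK//; exact: integrable_fin_num.
have EJ : \int[P]_w (J ^+ 2 * e n w ^+ 2 - score_avg n w ^+ 2) =
    J ^+ 2 * \int[P]_w e n w ^+ 2 - n%:R^-1 * V.
  by rewrite RintegralB ?RintegralZl ?EA//; exact: iZ.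
have iJ : P.-integrable setT (EFin \o (fun w => J ^+ 2 * e n w ^+ 2 - score_avg n w ^+ 2)).
  exact: (integrableB measurableT (iZ _ _ ie) iA).
have iB : P.-integrable setT (EFin \o (fun w =>
    2 * eta * score_avg n w ^+ 2 + 5 * eta * info_gap n w ^+ 2 +
    20 / eta ^+ 3 * tail4 del n w)).
  by apply: (iS); [apply: (iS); exact: iZ|exact: iZ].
have main : `|J ^+ 2 * \int[P]_w e n w ^+ 2 - n%:R^-1 * V| <=
    2 * eta * (n%:R^-1 * V) + 5 * eta * (n%:R^-1 * W) + 20 / eta ^+ 3 * (K * r ^+ n).
  rewrite -EJ (le_trans (le_normr_Rintegral measurableT iJ))//.
  have ij : P.-integrable setT (EFin \o (fun w => `|J ^+ 2 * e n w ^+ 2 - score_avg n w ^+ 2|)).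
    exact: (integrable_abse iJ).
  apply: (le_trans (le_Rintegral measurableT ij iB _)).
    by move=> w _; exact: error_pointwise.
  rewrite RintegralD//; [|by apply: (iS); exact: iZ|exact: iZ].
  rewrite RintegralD//; [|exact: iZ|exact: iZ].
  by rewrite !RintegralZl// EA ED lerD2l ler_wpM2l// divr_ge0// exprn_ge0// ltW.
move: (V) (J) main => v j main.
have -> : j ^+ 2 * (n%:R * \int[P]_w e n w ^+ 2) - v =
    n%:R * (j ^+ 2 * \int[P]_w e n w ^+ 2 - n%:R^-1 * v).
  by field; rewrite gt_eqF.
rewrite normrM ger0_norm// (le_trans (ler_wpM2l _ main))//.
rewrite le_eqVlt; apply/orP; left; apply/eqP.
by field; rewrite !gt_eqF.
Qed.

End estimator.

(** The likelihood is a positive constant times the power -m of the product, so comparisons are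
    reversed. *)
Lemma likelihood_le_prod (R : realType) (m : R) (n : nat) (x : nat -> R) (s t : R) : 1 / 2 < m ->
  pvii_likelihood m [tuple x (val i) | i < n] s <= pvii_likelihood m [tuple x (val i) | i < n] t ->
  \prod_(i < n) (1 + (x i - t) ^+ 2) <= \prod_(i < n) (1 + (x i - s) ^+ 2).
Proof.
move=> m2; have E u : pvii_likelihood m [tuple x (val i) | i < n] u =
    pvii_c m ^+ n * (\prod_(i < n) (1 + (x i - u) ^+ 2)) `^ (- m).
  rewrite /pvii_likelihood big_tuple.
  under eq_bigr do rewrite tnth_mktuple.
  rewrite big_split/= prodr_const card_ord (@prod_powR _ _ (fun i => 1 + (x i - u) ^+ 2))//.
  by move=> i; exact: ltW (sqrp1_gt0 _).
rewrite !E ler_pM2l ?exprn_gt0 ?pvii_c_gt0//.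
have Q0 u : 0 < \prod_(i < n) (1 + (x i - u) ^+ 2).
  by apply: prodr_gt0 => i _; exact: sqrp1_gt0.
rewrite !powRN lef_pV2 ?posrE ?powR_gt0// => H.
rewrite leNgt; apply/negP => lt; move: H; rewrite leNgt => /negP; apply.
by apply: gt0_ltr_powR; rewrite ?nnegrE ?(ltW (Q0 _))//; lra.
Qed.

Theorem theorem1p6 (R : realType) (m : R) (hm : 1 / 2 < m)
  (th : forall n : nat, n.-tuple R -> R)
  (th_meas : forall n : nat, measurable_fun setT (th n))
  (th_max : forall (n : nat) (x : n.-tuple R) (t : R),
      pvii_likelihood m x t <= pvii_likelihood m x (th n x))
  (theta : R) (d : measure_display) (T : measurableType d)
  (P : probability T R) (X : nat -> T -> R)
  (hlaw : forall i : nat, has_law_PVII P m theta (X i))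
  (hind : mutually_independent P X) :
  (\forall n \near \oo,
      ('E_P[fun w => ((mle_at th X n w - theta) ^+ 2)%R] < +oo)%E) /\
  (((n%:R)%R%:E * 'E_P[fun w => ((mle_at th X n w - theta) ^+ 2)%R])%E @[n --> \oo]
     --> ((m + 1) / (m * (2 * m - 1)))%:E).
Proof.
pose e n w := mle_at th X n w - theta.
have me n : measurable_fun setT (e n).
  apply: measurable_funB => //; apply: measurableT_comp (th_meas n) _.
  apply/measurable_fun_tnthP => i; rewrite (_ : _ \o _ = X i).
    by have [] := hlaw i.
  by apply/funext => w /=; rewrite tnth_mktuple.
have emin n w s : \prod_(i < n) (1 + (X i w - theta - e n w) ^+ 2) <=
    \prod_(i < n) (1 + (X i w - theta - s) ^+ 2).
  have H := @likelihood_le_prod R m n (X ^~ w) _ _ hm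
    (th_max n [tuple X (val i) w | i < n] (theta + s)).
  rewrite (eq_bigr (fun i : 'I_n => 1 + (X i w - mle_at th X n w) ^+ 2)); last first.
    by move=> i _; rewrite /e (_ : X i w - theta - _ = X i w - mle_at th X n w)//; ring.
  by under [leRHS]eq_bigr do rewrite -addrA -opprD.
have bound := scaled_error_bound hm hlaw hind me emin.
set J := (2 * m - 1) / (2 * (m + 1)) in bound; set V := (2 * m - 1) / (4 * m * (m + 1)) in bound.
set W := Rintegral _ _ _ in bound.
rewrite unlock.
have fin : \forall n \near \oo, (\int[P]_w ((e n w) ^+ 2)%:E)%E \is a fin_num.
  (* Any [eta] gives integrability; the successor of [n0] also excludes the empty sample. *)
  have [|n0 [K [r [_ H]]]] := bound 1; first by rewrite ltr01 /=.
  exists n0.+1 => // n /= n0n.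
  have [ie _] := H n (ltnW n0n) (leq_trans (ltn0Sn _) n0n).
  exact: integrable_fin_num.
split.
  by apply: filterS fin => n; rewrite fin_numE => /andP[_]; rewrite ltey.
have J0 : 0 < J by rewrite divr_gt0//; lra.
have V0 : 0 < V by rewrite divr_gt0//; [lra|rewrite !mulr_gt0//; lra].
have W0 : 0 <= W.
  by apply: Rintegral_ge0 => x _; rewrite mulr_ge0 ?sqr_ge0// ltW// pvii_f_gt0.
apply/fine_cvgP; split.
  by apply: filterS fin => n ?; rewrite fin_numM.
have -> : (m + 1) / (m * (2 * m - 1)) = V / J ^+ 2.
  by rewrite /V /J; field; rewrite !gt_eqF//; lra.
apply/cvgrPdist_le => eps eps0.
(* The summand 1 leaves room for the tail term, which is at most [eta] for large [n]; the total is
   then at most [eta * S]. *)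
pose S := 2 * V + 5 * W + 1.
have S0 : 0 < S by rewrite /S; lra.
pose eta := Num.min 1 (eps * J ^+ 2 / S).
have J20 : 0 < J ^+ 2 by rewrite exprn_gt0.
have eta0 : 0 < eta by rewrite lt_min ltr01/= divr_gt0// mulr_gt0.
have eta1 : eta <= 1 by rewrite ge_min lexx.
have etaS : eta * S <= eps * J ^+ 2 by rewrite -ler_pdivlMr// ge_min lexx orbT.
have eta01 : 0 < eta <= 1 by rewrite eta0.
have [n0 [K [r [r01 H]]]] := bound eta eta01.
have /cvgrPdist_le /(_ _ eta0) : K * (n%:R * r ^+ n) @[n --> \oo] --> (0 : R).
  by rewrite -[X in _ --> X](mulr0 K); apply: cvgM; [exact: cvg_cst|exact: cvg_natrM_expr].
move=> near0; near=> n.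
have nn0 : (n0 <= n)%N by near: n; exact: nbhs_infty_ge.
have n1 : (0 < n)%N by near: n; exact: nbhs_infty_gt.
have [ie Hn] := H n nn0 n1.
have Kn : K * (n%:R * r ^+ n) <= eta.
  have : `|0 - K * (n%:R * r ^+ n)| <= eta by near: n.
  by rewrite sub0r normrN => /(le_trans (ler_norm _)).
rewrite /= fineM//; last exact: integrable_fin_num.
rewrite /= -/(Rintegral P setT (fun w => e n w ^+ 2)).
set x := n%:R * _ in Hn *.
have -> : V / J ^+ 2 - x = (V - J ^+ 2 * x) / J ^+ 2 by field; rewrite gt_eqF.
rewrite normrM normfV (gtr0_norm J20) ler_pdivrMr// distrC (le_trans Hn)//.
by apply: le_trans etaS; rewrite /S; lra.
Unshelve. all: by end_near. Qed.
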